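(* Let $X$ be a real Hilbert space, $g\in\Gamma_0(X)$, $h:X\to\mathbb{R}$ convex and differentiable with $L$-Lipschitz gradient, $L\in]0,+\infty[$, and $f=g+h$, with $f$ bounded from below. For $\lambda\in]0,2L^{-1}[$ let $T_\lambda x=\operatorname{prox}_{\lambda g}(x-\lambda\nabla h(x))$. Fix $\lambda\in]0,2L^{-1}[$ and let $x_{n+1}=T_\lambda x_n$, $n\in\mathbb{N}$. Assume that $\Omega\subset X$ is FB-invariant and that: (a) $x_0\in\Omega$; (b) $f$ is $p$-Łojasiewicz on $\Omega$ with constant $c_{f,\Omega}$, for some $p\in]-\infty,0[\,\cup\,[1,+\infty[$. Set $r_n:=f(x_n)-\inf f$ and $\kappa:=\lambda(2-\lambda L)[2c_{f,\Omega}^2]^{-1}$. If $p\ge1$, then $\sum_n\|x_{n+1}-x_n\|<+\infty$, $(x_n)$ converges strongly to some $x_\infty\in\operatorname{argmin} f\neq\emptyset$, and there exist constants $C_p,C_p'>0$ such that: (i) if $p=1$: $x_n=x_\infty$ for every $n\ge r_0/\kappa$; (ii) if $p\in]1,2[$: for all $n\in\mathbb{N}$, $r_{n+1}\le(r_n/\kappa)^{\frac{p}{2(p-1)}}$ and $\|x_{n+1}-x_\infty\|\le C_p r_n^{1/2}$; (iii) if $p=2$: for all $n\in\mathbb{N}$, $r_{n+1}\le\frac1{1+\kappa}r_n$ and $\|x_{n+1}-x_\infty\|\le C_2r_0^{1/2}(1+\kappa)^{-n/2}$; (iv) if $p>2$: for all $n\in\mathbb{N}$, $r_n\le(C_p')^{p/(p-2)}n^{-\frac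 p{p-2}}$ and $\|x_{n+1}-x_\infty\|\le C_p(C_p')^{1/(p-2)}n^{-\frac1{p-2}}$. If $p<0$, there is a constant $C_p'>0$ such that for all $n\in\mathbb{N}$, $r_n\le(C_p')^{\frac p{p-2}}n^{\frac p{2-p}}$. When $0<r_0<+\infty$, these constants can be taken as follows, with $c:=c_{f,\Omega}$: $C_p=2pc(2-\lambda L)^{-1}+(2\lambda r_0)^{1/2}(2-\lambda L)^{-1/2}r_0^{-1/p}$ if $p\ge2$; $C_p=2pc\,r_0^{1/p}(2-\lambda L)^{-1}r_0^{-1/2}+(2\lambda)^{1/2}(2-\lambda L)^{-1/2}$ if $1\le p\le2$; and, for $p>2$ or $p<0$, $$(C_p')^{-1}=\min\left\{\kappa,\kappa^{\frac{p-2}{2p-2}}\right\}\max_{s\ge1}\min\left\{\frac{p-2}{ps},\ \kappa^{\frac{2-p}{2p-2}}r_0^{\frac{2-p}{p}}\left(1-s^{-\frac{p-2}{2p-2}}\right)\right\}.$$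
   Context: $\Gamma_0(X)$ is the set of proper, convex, lower semicontinuous functions $X\to]-\infty,+\infty]$. $\operatorname{prox}_{\lambda g}(x)=\operatorname{argmin}_{u\in X}\{g(u)+\frac1{2\lambda}\|u-x\|^2\}$. A set $\Omega\subset X$ is FB-invariant if $T_{\lambda'}\Omega\subset\Omega$ for all $\lambda'\in]0,2L^{-1}[$. $\operatorname{dom}^*f:=\operatorname{dom} f\setminus\operatorname{argmin} f$; $\|\partial f(x)\|_-:=\operatorname{dist}(0,\partial f(x))$, equal to $+\infty$ if $\partial f(x)=\emptyset$. For $p\in]-\infty,0[\,\cup\,[1,+\infty[$ and $f\in\Gamma_0(X)$ bounded from below, $f$ is $p$-Łojasiewicz on $\Omega$ with constant $c_{f,\Omega}>0$ if $(f(x)-\inf f)^{1-1/p}\le c_{f,\Omega}\|\partial f(x)\|_-$ for all $x\in\Omega\cap\operatorname{dom}^*f$. Right-hand sides are allowed to equal $+\infty$ (with $0^{-s}=+\infty$ for $s>0$; $r_0=+\infty$ if $x_0\notin\operatorname{dom} f$). *)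

(* Defs.v *)
From HB Require Import structures.
From mathcomp Require Import all_boot all_order all_algebra.
From mathcomp Require Import all_classical all_reals all_analysis.
Set Implicit Arguments.
Unset Strict Implicit.
Unset Printing Implicit Defensive.
Import Order.TTheory GRing.Theory Num.Theory.
Import numFieldNormedType.Exports.
Local Open Scope classical_set_scope.
Local Open Scope ring_scope.

Section ExtendedRealFunctions.
Context {R : realType} {X : normedModType R}.
Implicit Types (g : X -> \bar R) (x : X).
Local Open Scope ereal_scope.

Definition dom g : set X := [set x | g x < +oo].

Definition proper g := (forall x, g x != -oo) /\ dom g !=set0.

Definition convex_efun g := forall (x y : X) (t : R), (0 < t < 1)%R ->
  g (t *: x + (1 - t) *: y)%R <= t%:E * g x + (1 - t)%:E * g y.

Definition Gamma0 g :=
  [/\ proper g, convex_efun g & lower_semicontinuous g].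

Definition bounded_below g := exists m : R, forall x, m%:E <= g x.

Definition argmin g : set X := [set x | forall y, g x <= g y].

Definition dom_star g : set X := dom g `\` argmin g.

Definition inf_value g : \bar R := ereal_inf (range g).

(* Under the hypotheses of the theorem the argmin is a singleton, and [get]
   returns its element. *)
Definition prox (lambda : R) g x : X :=
  get (argmin (fun u => g u + ((2 * lambda)^-1 * `|u - x| ^+ 2)%:E)).

Definition forward_backward g (gradh : X -> X) (lambda : R) x : X :=
  prox lambda g (x - lambda *: gradh x)%R.

Definition FB_invariant g (gradh : X -> X) (L : R) (Omega : set X) :=
  forall lambda : R, (0 < lambda < 2 * L^-1)%R ->
    forward_backward g gradh lambda @` Omega `<=` Omega.

End ExtendedRealFunctions.

Section HilbertSpace.
Context {R : realType} {X : completeNormedModType R}.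
Variable dot : {dot X for @idfun R}.

(* The norm of X is the one induced by dot, so that X is a Hilbert space. *)
Definition induces_norm := forall x : X, dot x x = `|x| ^+ 2.

Definition is_gradient (h : X -> R) (gradh : X -> X) := forall x : X,
  differentiable (h : X -> R^o) x /\
  forall u : X, 'd (h : X -> R^o) x u = dot (gradh x) u.

Definition subdiff (f : X -> \bar R) (x : X) : set X :=
  [set v | forall y, (f x + (dot v (y - x))%:E <= f y)%E].

(* The infimum over the empty set is +oo. *)
Definition min_slope (f : X -> \bar R) (x : X) : \bar R :=
  edist_inf (subdiff f x) 0.

Definition lojasiewicz (f : X -> \bar R) (p c : R) (Omega : set X) :=
  forall x : X, (Omega `&` dom_star f) x ->
    ((f x - inf_value f) `^ (1 - p^-1) <= c%:E * min_slope f x)%E.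

End HilbertSpace.

Section Rates.
Context {R : realType}.

(* The library's [poweR] sends 0 to 0 (and +oo to +oo) for negative exponents;
   here 0 `^ (- s) = +oo for s > 0. *)
Definition epow (x : \bar R) (s : R) : \bar R :=
  if s < 0 then ((x `^ (- s))^-1)%E else (x `^ s)%E.

Definition is_max (A : set R) (M : R) := A M /\ ubound A M.

Definition kappa_of (lambda L c : R) : R :=
  lambda * (2 - lambda * L) * (2 * c ^+ 2)^-1.

Definition C_ge2 (lambda L c p r0 : R) : R :=
  2 * p * c * (2 - lambda * L)^-1
  + (2 * lambda * r0) `^ 2^-1 * (2 - lambda * L) `^ (- 2^-1) * r0 `^ (- p^-1).

Definition C_le2 (lambda L c p r0 : R) : R :=
  2 * p * c * r0 `^ p^-1 * (2 - lambda * L)^-1 * r0 `^ (- 2^-1)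
  + (2 * lambda) `^ 2^-1 * (2 - lambda * L) `^ (- 2^-1).

Definition C'_objective (kappa p r0 s : R) : R :=
  Num.min ((p - 2) / (p * s))
    (kappa `^ ((2 - p) / (2 * p - 2)) * r0 `^ ((2 - p) / p)
     * (1 - s `^ (- ((p - 2) / (2 * p - 2))))).

(* C' is the displayed constant; in particular the maximum is attained. *)
Definition is_C' (kappa p r0 C' : R) :=
  exists2 M, is_max [set C'_objective kappa p r0 s | s in `[1, +oo[] M
    & C'^-1 = Num.min kappa (kappa `^ ((p - 2) / (2 * p - 2))) * M.

End Rates.

(* Main.v *)
Require Import Defs.
From HB Require Import structures.
From mathcomp Require Import all_boot all_order all_algebra.
From mathcomp Require Import all_classical all_reals all_analysis.
From mathcomp Require Import ring lra.
Import Order.TTheory GRing.Theory Num.Theory.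
Import numFieldNormedType.Exports.
Local Open Scope classical_set_scope.
Local Open Scope ring_scope.

(** Let a = (2 - lambda L) / (2 lambda) and let y = T_lambda x be one
    forward-backward step.  Two facts about a step carry everything.

    - Sufficient decrease: f y + a |x - y|^2 <= f x.  It is the variational
      inequality of the proximal point y, tested at x, plus the descent lemma for h
      ([forward_backward_decrease]).
    - Small slope: f has at y a subgradient of norm at most |x - y| / lambda.  The
      residual of the optimality condition is
      ((x - lambda grad h x) - (y - lambda grad h y)) / lambda, and a gradient step
      of length at most 2 / L is nonexpansive by the Baillon-Haddad theorem
      ([forward_backward_slope]).

    Both presuppose that proximal points exist.  As f is bounded below and h is
    bounded on balls, g is bounded below on a ball around a point of its domain,
    hence by convexity it has a minorant that is affine in the distance to that
    point.  The proximal objective is therefore bounded below; its minimizing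
    sequences are Cauchy by the parallelogram identity and their limits are
    minimizers by lower semicontinuity ([prox_exists]).

    Write r_n for the gaps f (x_n) - inf f and d_n for the steps
    |x_(n+1) - x_n|.  The Lojasiewicz inequality turns the two facts into two
    inequalities between real numbers.

    - Squaring it gives r_n - r_(n+1) >= kappa r_(n+1)^(2 - 2/p) ([step_decay]).
      This is the whole source of the estimates on the values: the exponent is 0 for
      p = 1, between 0 and 1 for 1 < p < 2, 1 for p = 2, and larger than 1 for p > 2
      or p < 0.  In the last two cases the quantities r_n^(-(p-2)/p) grow by at least
      1 / C' per step: with s the maximizer in the definition of C', either
      consecutive gaps are comparable up to s and the convexity of the inverse power
      applies, or the gap drops by a definite factor ([inverse_power_growth]).
    - For p >= 1 the function phi(t) = p c t^(1/p) is concave, and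
      2 d_(n+1) <= d_n + 2 (phi(r_(n+1)) - phi(r_(n+2))) / (2 - lambda L)
      ([step_length]).  Summing, the steps from the (n+1)-st on have total length at
      most d_n + 2 phi(r_(n+1)) / (2 - lambda L) ([length_le]), while
      a d_n^2 <= r_n.  This yields finite length, strong convergence, and the
      constant C_p after both terms are expressed by the one of the powers r_n^(1/p)
      and r_n^(1/2) that has the smaller exponent.  The gaps tend to 0, so the limit
      is a minimizer by lower semicontinuity.

    The initial value may be infinite, but x_1 always lies in the domain of f.  The
    real estimates are therefore run from x_1 on, with a real number M in place of
    r_0 that bounds all finite gaps ([gap_bound]); when r_0 is positive and finite,
    M is r_0 and the constants are the announced ones.  The bound
    1 / C' <= M^(-(p-2)/p) makes the estimate hold from n = 1 on without any shift of
    the index, and for n = 0 the right-hand side is infinite. *)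

Set Implicit Arguments.
Unset Strict Implicit.

(** * The norm of a real Hilbert space *)

Section InnerProduct.
Context {R : realType} {X : completeNormedModType R}.
Variable dot : {dot X for @idfun R}.
Hypothesis hdot : induces_norm dot.
Implicit Types (u v w x y : X).

Lemma dotC u v : dot u v = dot v u.
Proof. by have /= := hermC dot u v; rewrite expr0 mul1r. Qed.

Lemma dotDr u v w : dot u (v + w) = dot u v + dot u w.
Proof. exact: linearDr. Qed.

Lemma dotNr u v : dot u (- v) = - dot u v.
Proof. exact: linearNr. Qed.

Lemma dotZr (a : R) u v : dot u (a *: v) = a * dot u v.
Proof. exact: linearZr_LR. Qed.

Lemma dotDl u v w : dot (u + v) w = dot u w + dot v w.
Proof. by rewrite dotC dotDr !(dotC w). Qed.

Lemma dotNl u v : dot (- u) v = - dot u v.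
Proof. by rewrite dotC dotNr dotC. Qed.

Lemma dotZl (a : R) u v : dot (a *: u) v = a * dot u v.
Proof. by rewrite dotC dotZr dotC. Qed.

Lemma dotBl u v w : dot (u - v) w = dot u w - dot v w.
Proof. by rewrite dotDl dotNl. Qed.

Lemma dotBr u v w : dot u (v - w) = dot u v - dot u w.
Proof. by rewrite dotDr dotNr. Qed.

Lemma normD_sqr u v : `|u + v| ^+ 2 = `|u| ^+ 2 + 2 * dot u v + `|v| ^+ 2.
Proof. by rewrite -!hdot dotDr !dotDl (dotC v u); ring. Qed.

Lemma normB_sqr u v : `|u - v| ^+ 2 = `|u| ^+ 2 - 2 * dot u v + `|v| ^+ 2.
Proof. by rewrite normD_sqr dotNr normrN; ring. Qed.

Lemma normZ_sqr (a : R) u : `|a *: u| ^+ 2 = a ^+ 2 * `|u| ^+ 2.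
Proof. by rewrite -!hdot dotZl dotZr; ring. Qed.

(** Expand the square of |v| u - |u| v. *)
Lemma dot_le_norm u v : dot u v <= `|u| * `|v|.
Proof.
have [u0|u0] := eqVneq u 0.
  by rewrite u0 -(scale0r 0) dotZl mul0r scale0r normr0 mul0r.
have [v0|v0] := eqVneq v 0.
  by rewrite v0 -(scale0r 0) dotZr mul0r scale0r normr0 mulr0.
have uv : 0 < `|u| * `|v| by rewrite mulr_gt0 ?normr_gt0.
have sq (a b : R) :
    0 <= a ^+ 2 * `|u| ^+ 2 - 2 * (a * (b * dot u v)) + b ^+ 2 * `|v| ^+ 2.
  by rewrite -dotZr -dotZl -!normZ_sqr -normB_sqr sqr_ge0.
rewrite -(ler_pM2l uv); have := sq `|v| `|u|; nra.
Qed.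

(** The parallelogram identity, arranged as the uniform convexity of the
    squared distance to a point z. *)
Lemma norm_midpoint_sqr u v z :
  `|2^-1 *: u + (1 - 2^-1) *: v - z| ^+ 2 =
  2^-1 * `|u - z| ^+ 2 + 2^-1 * `|v - z| ^+ 2 - 4^-1 * `|u - v| ^+ 2.
Proof.
have -> : 2^-1 *: u + (1 - 2^-1) *: v - z =
          2^-1 *: (u - z) + 2^-1 *: (v - z).
  have -> : 1 - 2^-1 = 2^-1 :> R by lra.
  rewrite !scalerBr addrACA -opprD -scalerDl.
  by have -> : 2^-1 + 2^-1 = 1 :> R; [lra | rewrite scale1r].
have -> : u - v = (u - z) - (v - z) by rewrite opprB addrA subrK.
by rewrite (normD_sqr (_ *: _)) !normZ_sqr (normB_sqr (u - z)) dotZl dotZr; field.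
Qed.

End InnerProduct.

(** * Convex functions with Lipschitz gradient *)

Section SmoothConvex.
Context {R : realType} {X : completeNormedModType R}.
Variable dot : {dot X for @idfun R}.
Hypothesis hdot : induces_norm dot.
Variables (h : X -> R) (gradh : X -> X).
Hypothesis hgrad : is_gradient dot h gradh.

(** Along a line the derivative of h has literally the same difference quotients
    as the directional derivative of h. *)
Lemma gradient_is_derive_line (x d : X) (t : R) :
  is_derive t (1 : R) (fun s : R => h (x + s *: d)) (dot (gradh (x + t *: d)) d).
Proof.
have [hdiff hgr] := hgrad (x + t *: d).
have e : (fun k : R => k^-1 *: (((fun s : R => h (x + s *: d)) \o shift t) (k *: (1 : R))
            - h (x + t *: d))) =
         (fun k : R => k^-1 *: (((h : X -> R^o) \o shift (x + t *: d)) (k *: d)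
            - h (x + t *: d))).
  apply/funext => k /=; congr (_ *: (h _ - _)).
  by have -> : k *: (1 : R) = k; [exact: mulr1 | rewrite scalerDl addrCA].
have dv : derivable (h : X -> R^o) (x + t *: d) d by exact: diff_derivable.
apply: DeriveDef.
  by rewrite /derivable e.
by rewrite /derive e -[LHS]/('D_d (h : X -> R^o) (x + t *: d)) deriveE // hgr.
Qed.

Section GradientInequality.
Hypothesis hconv : convex_function setT (h : X -> R^o).

(** By convexity no difference quotient of h along the segment from x to y
    exceeds h y - h x; let the step tend to 0. *)
Lemma convex_gradient_le (x y : X) : h x + dot (gradh x) (y - x) <= h y.
Proof.
have := gradient_is_derive_line x (y - x) 0; rewrite scale0r addr0 => -[dv dE].
have quot (t : R) : 0 < t -> t < 1 ->
    t^-1 * (h (x + t *: (y - x)) - h x) <= h y - h x.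
  move=> t0 t1.
  have /andP[t0' t1'] : (0 <= t) && (t <= 1) by rewrite !ltW.
  have hh : h (t *: y + (1 - t) *: x) <= t * h y + (1 - t) * h x.
    by have := hconv (Itv01 t0' t1') (mem_setT y) (mem_setT x).
  have e : t *: y + (1 - t) *: x = x + t *: (y - x).
    by rewrite scalerBl scale1r scalerBr addrCA.
  by rewrite ler_pdivrMl // -e; lra.
rewrite -lerBrDl -dE /derive cvg_at_rightE //; apply: limr_le.
  by apply: cvgP; apply: cvg_dnbhs_at_right dv.
near=> t; rewrite /= scale0r !addr0.
have -> : t *: (1 : R) = t by exact: mulr1.
by apply: quot.
Unshelve. all: by end_near. Qed.

End GradientInequality.

Section Lipschitz.
Variable L : R.
Hypothesis hlip : L.-lipschitz gradh.

Lemma lipschitz_dot_le (x y d : X) (t : R) : 0 <= t -> y - x = t *: d ->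
  dot (gradh y - gradh x) d <= L * t * `|d| ^+ 2.
Proof.
move=> t0 yx; apply: le_trans (dot_le_norm hdot _ _) _ => //.
have := @hlip (y, x) (conj I I); rewrite /= yx normrZ ger0_norm // => lip.
by rewrite expr2 mulrA ler_wpM2r // -mulrA.
Qed.

(** Apply the mean value theorem to h along the segment minus the quadratic
    polynomial of the right-hand side: the Lipschitz bound makes the derivative
    of this difference nonpositive. *)
Lemma descent_lemma (x y : X) :
  h y <= h x + dot (gradh x) (y - x) + L / 2 * `|y - x| ^+ 2.
Proof.
set d := y - x; set k := dot (gradh x) d; set m := L / 2 * `|d| ^+ 2.
pose phi : R -> R := (fun s : R => h (x + s *: d)) - k *: (id : R -> R)
  - m *: ((id : R -> R) ^+ 2).
have Dphi (t : R) : is_derive t (1 : R) phi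
    (dot (gradh (x + t *: d)) d - k - m * (2 * t)).
  have D1 := gradient_is_derive_line x d t.
  apply: is_derive_eq.
  by rewrite /GRing.scale /=; ring.
have [|t /[!in_itv]/= /andP[t0 t1]] := MVT_segment (@ler01 R) (fun t _ => Dphi t).
  by apply: derivable_within_continuous => t _; have [] := Dphi t.
rewrite subr0 mulr1 /phi !fctE /= scale1r scale0r addr0 => e.
have := @lipschitz_dot_le x (x + t *: d) d t t0.
rewrite addrAC subrr add0r => /(_ erefl); rewrite dotBl -/k => ht.
have xd : x + d = y by rewrite addrC subrK.
move: e; rewrite /GRing.scale /= xd => e.
have {}e : h y = h x + (dot (gradh (x + t *: d)) d - 2 * m * t + m).
  by apply/eqP; rewrite -subr_eq0; apply/eqP; move: e => /eqP;
    rewrite -subr_eq0 => /eqP <-; ring.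
have -> : h x + k + m = h x + (k + m) by rewrite addrA.
rewrite e lerD2l lerD2r; apply: le_trans (_ : _ <= k) _; last by [].
rewrite lerBlDr -lerBlDl (le_trans ht) // /m le_eqVlt; apply/orP; left.
by apply/eqP; field.
Qed.

Section Cocoercivity.
Hypothesis hconv : convex_function setT (h : X -> R^o).
Hypothesis hL : 0 < L.

(** Compare h and its tangent at x at the point reached from y by a gradient
    step of length 1 / L for the difference of h and that tangent. *)
Lemma gradient_gap_le (x y : X) :
  h x + dot (gradh x) (y - x) + (2 * L)^-1 * `|gradh y - gradh x| ^+ 2 <= h y.
Proof.
set w := gradh y - gradh x; pose z := y - L^-1 *: w.
have := le_trans (convex_gradient_le hconv x z) (descent_lemma y z).
have -> : z - y = - (L^-1 *: w) by rewrite /z addrAC subrr add0r.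
have -> : z - x = (y - x) - L^-1 *: w by rewrite /z addrAC.
rewrite !dotBr !dotNr !dotZr normrN (normZ_sqr hdot).
have ww : dot (gradh y) w - dot (gradh x) w = `|w| ^+ 2 by rewrite -dotBl hdot.
have -> : dot (gradh y) w = dot (gradh x) w + `|w| ^+ 2 by rewrite -ww addrC subrK.
have -> : L / 2 * (L^-1 ^+ 2 * `|w| ^+ 2) = L^-1 * `|w| ^+ 2 / 2.
  by field; rewrite gt_eqF.
have -> : (2 * L)^-1 * `|w| ^+ 2 = L^-1 * `|w| ^+ 2 / 2 by field; rewrite gt_eqF.
rewrite mulrDr; lra.
Qed.

(** The Baillon-Haddad theorem: add the previous bound to the one with x and y
    exchanged. *)
Lemma gradient_cocoercive (x y : X) :
  `|gradh x - gradh y| ^+ 2 <= L * dot (gradh x - gradh y) (x - y).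
Proof.
have := lerD (gradient_gap_le x y) (gradient_gap_le y x).
rewrite (distrC (gradh y)) -(opprB x y) dotNr dotBl.
set n2 := `|_| ^+ 2.
rewrite -(ler_pM2l hL) => gap.
have n2E : L * ((2 * L)^-1 * n2 + (2 * L)^-1 * n2) = n2.
  by field; rewrite gt_eqF.
move: gap n2E; rewrite !mulrDr !mulrN => gap n2E; lra.
Qed.

(** Expand the square; the cross term absorbs the quadratic one as long as the
    step is at most 2 / L. *)
Lemma gradient_step_nonexpansive (lambda : R) (x y : X) :
  0 <= lambda -> lambda * L <= 2 ->
  `|(x - y) - lambda *: (gradh x - gradh y)| <= `|x - y|.
Proof.
move=> l0 lL; rewrite -(@ler_pXn2r _ 2) ?nnegrE //.
rewrite (normB_sqr hdot) (normZ_sqr hdot) dotZr (dotC dot (x - y)).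
have := gradient_cocoercive x y; set D := dot _ _; set n2 := `|gradh x - _| ^+ 2.
move=> co; have D0 : 0 <= D.
  by rewrite -(pmulr_rge0 _ hL); apply: le_trans co; exact: sqr_ge0.
have : lambda ^+ 2 * n2 <= 2 * (lambda * D).
  apply: (le_trans (ler_wpM2l (sqr_ge0 lambda) co)).
  have : lambda * L * (lambda * D) <= 2 * (lambda * D).
    by apply: ler_wpM2r => //; exact: mulr_ge0.
  by apply: le_trans; rewrite le_eqVlt; apply/orP; left; apply/eqP; ring.
lra.
Qed.

End Cocoercivity.
End Lipschitz.
End SmoothConvex.

(** * Lower semicontinuity and completeness *)

Section LowerSemicontinuity.
Context {R : realType} {X : normedModType R}.
Implicit Types (g : X -> \bar R) (q : X -> R) (u : nat -> X).

Lemma lower_semicontinuousD g q :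
  lower_semicontinuous g -> continuous q ->
  lower_semicontinuous (fun x => g x + (q x)%:E)%E.
Proof.
move=> lscg cq x a ax.
have [b [ab bg]] : exists b : R, a < b + q x /\ (b%:E < g x)%E.
  move: ax; case: (g x) => [s| |] /=.
  - rewrite -EFinD lte_fin => ax; exists ((a - q x + s) / 2).
    by rewrite lte_fin; split; lra.
  - by move=> _; exists (a - q x + 1); rewrite ltry; split => //; lra.
  - by [].
have [V xV Vb] := lscg x b bg.
have nq : \forall y \near x, a - b < q y.
  by apply: (cvgr_gt (q x)); [exact: cq | lra].
exists (V `&` [set y | a - b < q y]); first exact: filterI.
move=> y [/Vb by_ /= aq]; apply: lt_trans (_ : ((b + q y)%:E < _)%E).
  by rewrite lte_fin; lra.
by rewrite EFinD lteD2rE.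
Qed.

Lemma lsc_cvg_le g u (x : X) (m : R) :
  lower_semicontinuous g -> u n @[n --> \oo] --> x ->
  (forall e : R, 0 < e -> \forall n \near \oo, (g (u n) <= (m + e)%:E)%E) ->
  (g x <= m%:E)%E.
Proof.
move=> lscg ux gu; rewrite leNgt; apply/negP => mg.
have [b [mb bg]] : exists b : R, m < b /\ (b%:E < g x)%E.
  move: mg; case: (g x) => [s| |] //=.
  - by rewrite lte_fin => ms; exists ((m + s) / 2); rewrite lte_fin; split; lra.
  - by move=> _; exists (m + 1); rewrite ltry; split => //; lra.
have [V xV Vb] := lscg x b bg.
have e0 : 0 < (b - m) by lra.
near \oo => n; have : (b%:E < g (u n))%E.
  by apply: Vb; near: n; exact: ux.
have : (g (u n) <= (m + (b - m))%:E)%E by near: n; exact: gu.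
by rewrite addrC subrK leNgt => /negbTE->.
Unshelve. all: by end_near. Qed.

End LowerSemicontinuity.

Section CauchySequences.
Context {R : realType} {X : completeNormedModType R}.
Implicit Types u : nat -> X.

Lemma cauchy_modulus_cvg u :
  (forall e : R, 0 < e -> exists N, forall m n, (N <= m)%N -> (N <= n)%N ->
     `|u m - u n| < e) -> cvgn u.
Proof.
move=> cu; apply: cauchy_cvg; apply: cauchy_exP => e e0.
have [N uN] := cu e e0; exists (u N); exists N => // n /= Nn.
by rewrite -ball_normE /=; exact: uN.
Qed.

End CauchySequences.

(** * Proximal points *)

Section Prox.
Context {R : realType} {X : completeNormedModType R}.
Variable dot : {dot X for @idfun R}.
Hypothesis hdot : induces_norm dot.
Variables (g : X -> \bar R) (lambda : R).
Hypotheses (hg : Gamma0 g) (hlambda : 0 < lambda).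

Lemma Gamma0_neqNy (x : X) : g x != -oo%E.
Proof. by have [[gN _] _ _] := hg. Qed.

(** Convexity turns a lower bound on the unit ball around a point of the domain
    into a lower bound that is affine in the distance to that point. *)
Lemma convex_linear_minorant (x0 : X) (m : R) :
  dom g x0 -> (forall x, `|x - x0| <= 1 -> (m%:E <= g x)%E) ->
  exists2 K : R, 0 <= K & forall x, ((- (K * (1 + `|x - x0|)))%:E <= g x)%E.
Proof.
move=> dx0 gm; have [_ cg _] := hg.
move: (Gamma0_neqNy x0) dx0; rewrite /dom /=.
case gx0 : (g x0) => [a| |] // _ _.
exists (`|m| + `|a|); first by rewrite addr_ge0.
(* Outside the unit ball, use the point of the segment from x0 to x at distance 1
   from x0. *)
move=> x; have [x1|x1] := leP `|x - x0| 1.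
  apply: le_trans (gm x x1); rewrite lee_fin.
  have := normr_ge0 (x - x0); have := ler_norm (- m); rewrite normrN.
  have := normr_ge0 a; have := normr_ge0 m; nra.
set s := `|x - x0| in x1 *; have s0 : 0 < s by lra.
have t01 : 0 < s^-1 < 1 by rewrite invr_gt0 s0 invf_lt1.
have := cg x x0 _ t01; rewrite gx0.
have nb : `|s^-1 *: x + (1 - s^-1) *: x0 - x0| <= 1.
  rewrite scalerBl scale1r addrCA addrAC subrr add0r -scalerBr normrZ.
  by rewrite gtr0_norm ?invr_gt0 // mulVf ?gt_eqF.
move: (Gamma0_neqNy x); case: (g x) => [b| |] // _; last by rewrite leey.
move/(le_trans (gm _ nb)); rewrite -!EFinM -EFinD !lee_fin => mb.
have : s * m <= b + (s - 1) * a.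
  have -> : b + (s - 1) * a = s * (s^-1 * b + (1 - s^-1) * a).
    by field; rewrite gt_eqF.
  by rewrite ler_pM2l.
have := ler_norm (- m); have := ler_norm a; rewrite normrN.
have := normr_ge0 a; have := normr_ge0 m; nra.
Qed.

(** Convexity at the midpoint for an objective with quadratic part c: a and b
    measure how far the values at the two endpoints are from the infimum m. *)
Lemma near_min_midpoint_gap (c m gk gn gm A B D a b : R) :
  gk + c * A < m + a -> gn + c * B < m + b ->
  m <= gm + c * (2^-1 * A + 2^-1 * B - 4^-1 * D) ->
  gm <= 2^-1 * gk + (1 - 2^-1) * gn -> c * D <= 2 * (a + b).
Proof. lra. Qed.

Let prox_objective (z u : X) : \bar R :=
  (g u + ((2 * lambda)^-1 * `|u - z| ^+ 2)%:E)%E.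

(** A minimizing sequence is Cauchy by the uniform convexity of the squared
    distance, and its limit is a minimizer by lower semicontinuity. *)
Lemma prox_exists (x0 : X) (K : R) (z : X) :
  0 <= K -> (forall x, ((- (K * (1 + `|x - x0|)))%:E <= g x)%E) ->
  argmin (prox_objective z) !=set0.
Proof.
move=> K0 gK; have [[gN [a da]] cg lscg] := hg.
set G := prox_objective z; pose c := (2 * lambda)^-1.
have c0 : 0 < c by rewrite invr_gt0 mulr_gt0.
(* The quadratic dominates the linear minorant; the constant comes from completing
   the square. *)
have Glb u : ((- (K * (1 + `|z - x0|)) - K ^+ 2 / (4 * c))%:E <= G u)%E.
  have tri : `|u - x0| <= `|u - z| + `|z - x0|.
    exact: ler_distD.
  apply: (@le_trans _ _ ((- (K * (1 + `|u - x0|)) + c * `|u - z| ^+ 2)%:E)).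
    rewrite lee_fin.
    have sq : K * `|u - z| <= c * `|u - z| ^+ 2 + K ^+ 2 / (4 * c).
      rewrite -subr_ge0.
      have -> : c * `|u - z| ^+ 2 + K ^+ 2 / (4 * c) - K * `|u - z| =
                c * (`|u - z| - K / (2 * c)) ^+ 2 by field; rewrite gt_eqF.
      by rewrite mulr_ge0 ?sqr_ge0 // ltW.
    nra.
  by rewrite EFinD leeD2rE.
pose I := ereal_inf (range G).
have Ile u : (I <= G u)%E by apply: ereal_inf_lbound; exists u.
have Ifin : I \is a fin_num.
  rewrite fin_numElt; apply/andP; split.
    by apply: (lt_le_trans (ltNyr _)); apply: le_ereal_inf_tmp => _ [u _ <-]; exact: Glb.
  apply: (le_lt_trans (Ile a)); rewrite /G /prox_objective.
  by move: da; rewrite /dom /=; case: (g a) => [r| |] // _; rewrite -EFinD ltry.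
pose m := fine I; have mI : I = m%:E by rewrite /m fineK.
have /choice[u hu] : forall n : nat, exists v, (G v < (m + n.+1%:R^-1)%:E)%E.
  move=> n; have n0 : 0 < (n.+1%:R^-1 : R) by rewrite invr_gt0.
  have [_ [v _ <-] hv] := lb_ereal_inf_adherent n0 Ifin.
  by exists v; rewrite EFinD -mI.
have gap (k n : nat) :
    `|u k - u n| ^+ 2 <= 2 / c * (k.+1%:R^-1 + n.+1%:R^-1).
  have h01 : 0 < (2^-1 : R) < 1 by apply/andP; split; lra.
  have := cg (u k) (u n) _ h01.
  have := Ile (2^-1 *: u k + (1 - 2^-1) *: u n).
  move: (hu k) (hu n); rewrite mI /G /prox_objective (norm_midpoint_sqr hdot).
  move: (Gamma0_neqNy (u k)) (Gamma0_neqNy (u n)).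
  case: (g (u k)) => [gk| |] //; case: (g (u n)) => [gn| |] // _ _.
  case: (g (_ + _)) => [gm| |] //; rewrite -?EFinD -?EFinM -?EFinD !lee_fin !lte_fin.
  rewrite -/c => uk un lb cv.
  have : c * `|u k - u n| ^+ 2 <= 2 * (k.+1%:R^-1 + n.+1%:R^-1).
    exact: near_min_midpoint_gap uk un lb cv.
  by rewrite -ler_pdivlMl // mulrA (mulrC c^-1).
have /cvg_ex[y uy] : cvgn u.
  apply: cauchy_modulus_cvg => e e0.
  pose N := Num.truncn (4 / (c * e ^+ 2)); exists N => k n Nk Nn.
  have c4 : 0 < 4 / (c * e ^+ 2) by rewrite divr_gt0 // mulr_gt0 // exprn_gt0.
  have inv_le (i : nat) : (N <= i)%N -> (i.+1%:R^-1 : R) < c * e ^+ 2 / 4.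
    move=> Ni; rewrite -[ltRHS]invrK ltf_pV2 ?posrE //.
      by rewrite invf_div; apply: (lt_le_trans (truncnS_gt _)); rewrite ler_nat.
    by rewrite invf_div.
  rewrite -(@ltr_pXn2r _ 2) ?nnegrE // ?(ltW e0) //.
  apply: (le_lt_trans (gap k n)); rewrite mulrAC ltr_pdivrMr //.
  have := inv_le k Nk; have := inv_le n Nn.
  by move: (k.+1%:R^-1 : R) (n.+1%:R^-1 : R) (e ^+ 2) => A B E hA hB; lra.
exists y => v; apply: le_trans (Ile v); rewrite mI.
apply: (lsc_cvg_le _ uy).
  apply: lower_semicontinuousD lscg _ => w.
  have cn : (fun w : X => `|w - z|) @ w --> `|w - z|.
    by apply: cvg_norm; apply: cvgB; [exact: cvg_id | exact: cvg_cst].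
  by apply: cvgM; [exact: cvg_cst | exact: (cvgM cn cn)].
move=> e e0; exists (Num.truncn e^-1) => // n /= Nn; apply: ltW.
apply: (lt_le_trans (hu n)); rewrite lee_fin lerD2l.
rewrite -[leRHS]invrK lef_pV2 ?posrE ?invr_gt0 //.
by apply: ltW; apply: (lt_le_trans (truncnS_gt _)); rewrite ler_nat.
Qed.
Lemma ge0_of_small_steps (A B : R) :
  (forall t, 0 < t < 1 -> 0 <= A + t * B) -> 0 <= A.
Proof.
move=> AB; rewrite leNgt; apply/negP => A0.
have B0 := normr_ge0 B; have den : 0 < 2 * (`|B| - A) by lra.
(* This step makes |t B| at most half of - A. *)
have t01 : 0 < - A / (2 * (`|B| - A)) < 1.
  by rewrite divr_gt0 ?oppr_gt0 //= ltr_pdivrMr //; lra.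
have := AB _ t01; set t := _ / _ in t01 *.
have tE : t * (2 * (`|B| - A)) = - A by rewrite divfK // gt_eqF.
have tB : t * B <= t * `|B| by rewrite ler_wpM2l ?ler_norm //; lra.
have : t * A < 0 by rewrite nmulr_llt0 //; lra.
lra.
Qed.

Lemma prox_objective_dom (y z : X) : argmin (prox_objective z) y -> dom g y.
Proof.
move=> ymin; have [[_ [a da]] _ _] := hg.
have := ymin a; rewrite /prox_objective; move: da (Gamma0_neqNy y).
rewrite /dom /=; case: (g a) => [r| |] // _; case: (g y) => [s| |] // _.
by rewrite ltry.
Qed.

(** First order optimality: compare y with the points close to y on the segment
    from y to u. *)
Lemma prox_variational (y z u : X) : argmin (prox_objective z) y ->
  (g y + (lambda^-1 * dot (z - y) (u - y))%:E <= g u)%E.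
Proof.
move=> ymin; have [_ cg _] := hg.
move: (prox_objective_dom ymin) (Gamma0_neqNy y) (Gamma0_neqNy u).
rewrite /dom /=; case gy : (g y) => [b| |] // _ _.
case gu : (g u) => [a| |] // _; last by rewrite leey.
rewrite -EFinD lee_fin -subr_ge0.
apply: (@ge0_of_small_steps _ ((2 * lambda)^-1 * `|u - y| ^+ 2)) => t t01.
have := cg u y t t01; have := ymin (t *: u + (1 - t) *: y).
rewrite /prox_objective gy gu.
have -> : t *: u + (1 - t) *: y - z = (y - z) + t *: (u - y).
  by rewrite scalerBl scale1r scalerBr addrCA addrAC.
rewrite (normD_sqr hdot (y - z)) (normZ_sqr hdot) dotZr.
rewrite -(opprB z y) normrN dotNl.
case: (g (_ + _)) => [r| |] //; rewrite -?EFinM -?EFinD !lee_fin.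
move=> h1 h2.
have t0 : 0 < t by case/andP: t01.
rewrite -(pmulr_rge0 _ t0).
have lE : lambda^-1 = 2 * (2 * lambda)^-1 by field; rewrite gt_eqF.
rewrite lE; move: h1 h2; move: (2 * lambda)^-1 => c; lra.
Qed.

Lemma prox_argmin (x0 : X) (K : R) (z : X) :
  0 <= K -> (forall x, ((- (K * (1 + `|x - x0|)))%:E <= g x)%E) ->
  argmin (prox_objective z) (prox lambda g z).
Proof. by move=> K0 gK; apply: getPex; exact: prox_exists K0 gK. Qed.

End Prox.

(** * One forward-backward step *)

Section MinimalSlope.
Context {R : realType} {X : completeNormedModType R}.
Variable dot : {dot X for @idfun R}.

Lemma min_slope_le (f : X -> \bar R) (x v : X) :
  subdiff dot f x v -> (min_slope dot f x <= `|v|%:E)%E.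
Proof.
move=> fv; apply: (@le_trans _ _ (edist (0, v))).
  by apply: ereal_inf_lbound; exists v.
apply/lee_addgt0Pr => e e0; apply: ereal_inf_lbound.
exists (`|v| + e) => //=; split; first by rewrite ltr_wpDl.
by rewrite -ball_normE /= sub0r normrN ltrDl.
Qed.

End MinimalSlope.

Section ForwardBackwardStep.
Context {R : realType} {X : completeNormedModType R}.
Variable dot : {dot X for @idfun R}.
Hypothesis hdot : induces_norm dot.
Variables (g : X -> \bar R) (h : X -> R) (gradh : X -> X) (L lambda : R).
Variable f : X -> \bar R.
Hypotheses (hg : Gamma0 g) (hL : 0 < L).
Hypothesis hconv : convex_function setT (h : X -> R^o).
Hypothesis hgrad : is_gradient dot h gradh.
Hypothesis hlip : L.-lipschitz gradh.
Hypothesis hf : forall u, f u = (g u + (h u)%:E)%E.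
Hypothesis hbound : bounded_below f.
Hypothesis hlambda : 0 < lambda < 2 * L^-1.

Lemma step_gt0 : 0 < lambda. Proof. by case/andP: hlambda. Qed.

Lemma step_lipschitz_lt2 : lambda * L < 2.
Proof. by case/andP: hlambda => _; rewrite -ltr_pdivlMr. Qed.

Lemma dom_sum (x : X) : dom f x <-> dom g x.
Proof.
by rewrite /dom /= hf; case: (g x) => [r| |] //=; rewrite -?EFinD ?ltry.
Qed.

(** Since f is bounded below and h is bounded on balls, g is bounded below on
    balls, which is all the existence of proximal points asks for. *)
Lemma sum_prox_argmin (z : X) :
  argmin (fun u => g u + ((2 * lambda)^-1 * `|u - z| ^+ 2)%:E)%E
    (prox lambda g z).
Proof.
have [[_ [a da]] _ _] := hg; have [m fm] := hbound.
have gball u : `|u - a| <= 1 -> ((m - (h a + `|gradh a| + L / 2))%:E <= g u)%E.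
  move=> ua; have := fm u; rewrite hf.
  move: (Gamma0_neqNy hg u); case: (g u) => [r| |] // _; last by move=> _; rewrite leey.
  rewrite -EFinD !lee_fin => mr.
  have hu := descent_lemma hdot hgrad hlip a u.
  have du := dot_le_norm hdot (gradh a) (u - a).
  have n1 : `|gradh a| * `|u - a| <= `|gradh a| by rewrite ler_piMr.
  have n2 : L / 2 * `|u - a| ^+ 2 <= L / 2.
    by rewrite ler_piMr ?exprn_ile1 ?divr_ge0 ?(ltW hL).
  lra.
have [K K0 gK] := convex_linear_minorant hg da gball.
exact: (prox_argmin hdot hg step_gt0 z K0 gK).
Qed.

Section Step.
Variable x : X.
Let y := forward_backward g gradh lambda x.

Lemma forward_backward_dom : dom f y.
Proof. by apply/dom_sum; exact: (prox_objective_dom hg (sum_prox_argmin _)). Qed.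

(** Optimality of the proximal point, with the forward step expanded.  At u = x
    it gives the decrease of f, and over all u a subgradient of f. *)
Lemma forward_backward_variational (u : X) :
  (g y + (lambda^-1 * dot (x - y) (u - y) - dot (gradh x) (u - y))%:E <= g u)%E.
Proof.
have := prox_variational hdot hg step_gt0 u (sum_prox_argmin (x - lambda *: gradh x)).
rewrite -/(forward_backward g gradh lambda x) -/y addrAC dotBl dotZl mulrBr.
by rewrite mulKf ?gt_eqF // step_gt0.
Qed.

(** Add the descent lemma for h between x and y. *)
Lemma forward_backward_decrease :
  (f y + ((2 - lambda * L) / (2 * lambda) * `|x - y| ^+ 2)%:E <= f x)%E.
Proof.
have := forward_backward_variational x; rewrite !hf hdot.
have hy := descent_lemma hdot hgrad hlip x y.
move: (Gamma0_neqNy hg x) (Gamma0_neqNy hg y).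
case: (g x) => [a| |] // _; last by move=> _ _; rewrite addye // leey.
case: (g y) => [b| |] // _.
rewrite -?EFinD !lee_fin => gxy.
move: hy; rewrite -(opprB x y) dotNr normrN => hy.
have -> : (2 - lambda * L) / (2 * lambda) = lambda^-1 - L / 2.
  by field; rewrite gt_eqF // step_gt0.
rewrite mulrBl; lra.
Qed.

(** The residual of the optimality condition at y is a subgradient of f, and it
    is no longer than the step because the gradient step is nonexpansive. *)
Lemma forward_backward_slope :
  (min_slope dot f y <= (lambda^-1 * `|x - y|)%:E)%E.
Proof.
pose v := lambda^-1 *: ((x - y) - lambda *: (gradh x - gradh y)).
apply: (@le_trans _ _ `|v|%:E); last first.
  rewrite lee_fin normrZ gtr0_norm ?invr_gt0 ?step_gt0 // ler_pM2l ?invr_gt0 ?step_gt0 //.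
  apply: (gradient_step_nonexpansive hdot hgrad hlip hconv hL).
    exact/ltW/step_gt0.
  exact/ltW/step_lipschitz_lt2.
apply: min_slope_le => u /=.
have := forward_backward_variational u; rewrite !hf.
have hu := convex_gradient_le hgrad hconv y u.
move: (Gamma0_neqNy hg u) (Gamma0_neqNy hg y).
case: (g u) => [a| |] // _; last by move=> _ _; rewrite addye // leey.
case: (g y) => [b| |] // _.
rewrite -?EFinD !lee_fin => gyu.
rewrite /v dotZl dotBl dotZl (dotBl dot (gradh x)) mulrBr mulKf ?gt_eqF ?step_gt0 //.
lra.
Qed.

End Step.

End ForwardBackwardStep.

(** * Tangent inequalities for powers *)

Section PowerInequalities.
Context {R : realType}.
Implicit Types (u v w s alpha gamma : R).

Lemma ln_le_sub1 w : 0 < w -> ln w <= w - 1.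
Proof.
by move=> w0; have := @le_ln1Dx R (w - 1); rewrite addrCA subrr addr0; apply; lra.
Qed.

(** Bernoulli's inequality for exponents below 1; it follows from ln z <= z - 1
    at the points w / s and 1 / s, where s is the right-hand side. *)
Lemma powR_le_tangent w alpha : 0 <= w -> 0 < alpha <= 1 ->
  w `^ alpha <= 1 + alpha * (w - 1).
Proof.
move=> w0 /andP[a0 a1]; have [->|wn0] := eqVneq w 0.
  by rewrite powR0 ?gt_eqF //; lra.
have {w0 wn0} w0 : 0 < w by rewrite lt_neqAle eq_sym wn0.
set s := 1 + _; have s0 : 0 < s.
  have : 0 < alpha * w by rewrite mulr_gt0.
  by rewrite /s; lra.
rewrite /powR gt_eqF // -[leRHS]lnK ?posrE // ler_expR.
have l1 := ln_le_sub1 (divr_gt0 w0 s0).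
have l2 := ln_le_sub1 (divr_gt0 ltr01 s0).
move: l1 l2; rewrite !ln_div ?posrE // ln1 => l1 l2.
have sE : alpha * (w / s) + (1 - alpha) * (1 / s) = 1.
  by rewrite /s; field; rewrite -/s gt_eqF // ; lra.
have l3 : alpha * (ln w - ln s) <= alpha * (w / s - 1) by rewrite ler_pM2l.
have l4 : (1 - alpha) * (0 - ln s) <= (1 - alpha) * (1 / s - 1).
  by rewrite ler_wpM2l //; lra.
lra.
Qed.

(** The tangent inequality of the concave function t^alpha at u, obtained from
    the case u = 1 by homogeneity. *)
Lemma powR_concave_gap u v alpha : 0 < u -> 0 <= v -> 0 < alpha <= 1 ->
  alpha * u `^ (alpha - 1) * (u - v) <= u `^ alpha - v `^ alpha.
Proof.
move=> u0 v0 ha; have w0 : 0 <= v / u by rewrite divr_ge0 // ltW.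
have := powR_le_tangent w0 ha.
have vE : v `^ alpha = u `^ alpha * (v / u) `^ alpha.
  by rewrite -powRM // ?(ltW u0) // mulrCA divff ?mulr1 // gt_eqF.
have uE : u `^ alpha = u `^ (alpha - 1) * u.
  by rewrite -{3}(powRr1 (ltW u0)) -powRD ?subrK // (gt_eqF u0) implybT.
have ua0 := powR_gt0 (alpha - 1) u0.
move=> tg; rewrite vE uE.
have : u `^ (alpha - 1) * u * (v / u) `^ alpha
       <= u `^ (alpha - 1) * u * (1 + alpha * (v / u - 1)).
  by rewrite ler_pM2l // mulr_gt0.
have -> : u `^ (alpha - 1) * u * (1 + alpha * (v / u - 1)) =
   u `^ (alpha - 1) * u + u `^ (alpha - 1) * (alpha * (v - u)).
  by field; rewrite gt_eqF.
lra.
Qed.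

(** The tangent inequality of the convex function t^(- gamma) at u, reduced by
    homogeneity to (u / v)^gamma >= 1 + gamma ln (u / v) and
    ln (u / v) >= 1 - v / u. *)
Lemma powRN_convex_gap u v gamma : 0 < v -> v <= u -> 0 < gamma ->
  gamma * u `^ (- (gamma + 1)) * (u - v) <= v `^ (- gamma) - u `^ (- gamma).
Proof.
move=> v0 vu g0; have u0 := lt_le_trans v0 vu.
have uE : u `^ (- (gamma + 1)) = u `^ (- gamma) * u^-1.
  rewrite opprD powRD; last by rewrite (gt_eqF u0) implybT.
  by rewrite powR_inv1 // ltW.
have vE : v `^ (- gamma) = u `^ (- gamma) * (u / v) `^ gamma.
  rewrite powRM ?invr_ge0 ?(ltW u0) ?(ltW v0) // mulrA -powRD;
    last by rewrite (gt_eqF u0) implybT.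
  by rewrite addNr powRr0 mul1r -{2}(powRr1 (ltW v0)) -powRN -powRrM mulN1r.
have ug := powR_gt0 (- gamma) u0.
rewrite uE vE.
have tg : 1 + gamma * (1 - v / u) <= (u / v) `^ gamma.
  rewrite /powR gt_eqF ?divr_gt0 //.
  apply: le_trans (expR_ge1Dx _); rewrite lerD2l ler_pM2l //.
  have := ln_le_sub1 (divr_gt0 v0 u0).
  by rewrite !ln_div ?posrE //; lra.
have : u `^ (- gamma) * (1 + gamma * (1 - v / u)) <= u `^ (- gamma) * (u / v) `^ gamma.
  by rewrite ler_pM2l.
have -> : gamma * (u `^ (- gamma) * u^-1) * (u - v) =
  u `^ (- gamma) * (gamma * (1 - v / u)).
  by field; rewrite gt_eqF.
lra.
Qed.

End PowerInequalities.

(** * Decay of the values and length of the steps *)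

Section StepInequalities.
Context {R : realType}.
Variables (p c lambda L : R).
Hypotheses (hc : 0 < c) (hl : 0 < lambda) (hlL : lambda * L < 2).

Let a := (2 - lambda * L) / (2 * lambda).

Lemma decrease_rate_gt0 : 0 < a.
Proof. by rewrite divr_gt0 ?subr_gt0 // mulr_gt0. Qed.

Lemma kappa_gt0 : 0 < kappa_of lambda L c.
Proof.
by rewrite mulr_gt0 ?invr_gt0 ?mulr_gt0 ?exprn_gt0 ?subr_gt0.
Qed.

(** Squaring the Lojasiewicz inequality and inserting it into the sufficient
    decrease. *)
Lemma step_decay (r r' d : R) :
  a * d ^+ 2 <= r - r' -> r' `^ (1 - p^-1) <= c * (lambda^-1 * d) ->
  kappa_of lambda L c * r' `^ (2 - 2 / p) <= r - r'.
Proof.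
move=> dec loj; apply: le_trans dec.
have -> : 2 - 2 / p = (1 - p^-1) * 2%:R by rewrite mulrBl mul1r (mulrC _ 2%:R).
rewrite powRrM powR_mulrn ?powR_ge0 //.
have sq : (r' `^ (1 - p^-1)) ^+ 2 <= (c * (lambda^-1 * d)) ^+ 2.
  by rewrite lerXn2r ?nnegrE ?powR_ge0 // (le_trans (powR_ge0 _ _) loj).
apply: (le_trans (ler_wpM2l (ltW kappa_gt0) sq)).
rewrite le_eqVlt; apply/orP; left; apply/eqP; rewrite /kappa_of /a.
by field; rewrite !gt_eqF.
Qed.

(** Desingularization: with phi(t) = p c t^(1/p) the Lojasiewicz inequality says
    that the slope of phi \o (f - inf f) is at least 1, so the next step is
    controlled by the decrease of this function and, through the
    arithmetic-geometric inequality, by half of the present step. *)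
Lemma step_length (r r' d d' : R) : 1 <= p -> 0 <= r -> 0 <= r' ->
  0 <= d -> 0 <= d' ->
  a * d' ^+ 2 <= r - r' ->
  (0 < r -> r `^ (1 - p^-1) <= c * (lambda^-1 * d)) ->
  2 * d' <= d + 2 * p * c / (2 - lambda * L) * (r `^ p^-1 - r' `^ p^-1).
Proof.
move=> p1 r0 r'0 d0 d'0 dec loj; have p0 : 0 < p := lt_le_trans ltr01 p1.
have a0 := decrease_rate_gt0.
have ad : 0 <= a * d' ^+ 2 by rewrite mulr_ge0 ?sqr_ge0 ?ltW.
have [re|rn] := eqVneq r 0.
  have r'e : r' = 0 by lra.
  have : d' ^+ 2 <= 0 by rewrite -(pmulr_rle0 _ a0); lra.
  rewrite -subr_ge0 sub0r oppr_ge0 => d2.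
  have /eqP : d' ^+ 2 == 0 by rewrite eq_le d2 sqr_ge0.
  move/eqP; rewrite expf_eq0 /= => /eqP ->.
  by rewrite re r'e subrr !mulr0 addr0.
have {rn r0} r0 : 0 < r by rewrite lt_neqAle eq_sym rn.
have {}loj := loj r0.
have ip : 0 < p^-1 <= 1 by rewrite invr_gt0 p0 invf_le1.
have cg := powR_concave_gap r0 r'0 ip; set delta := r `^ _ - _ in cg *.
set s := r `^ (1 - p^-1) in loj.
have s0 : 0 < s by exact: powR_gt0.
have sE : r `^ (p^-1 - 1) = s^-1 by rewrite /s -powRN opprB.
have k1 : a * d' ^+ 2 <= p * (s * delta).
  apply: (le_trans dec); rewrite mulrCA -ler_pdivrMl // -ler_pdivrMl //.
  by apply: le_trans cg; rewrite sE mulrA.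
have delta0 : 0 <= delta.
  rewrite -(pmulr_rge0 _ s0) -(pmulr_rge0 _ p0); exact: le_trans k1.
set b := 2 * p * c / (2 - lambda * L).
have b0 : 0 <= b by rewrite divr_ge0 ?mulr_ge0 ?subr_ge0 // ltW.
have k2 : d' ^+ 2 <= d * (b * delta).
  have k3 : a * d' ^+ 2 <= p * (c * (lambda^-1 * d) * delta).
    by apply: (le_trans k1); rewrite ler_pM2l // ler_wpM2r.
  rewrite -(ler_pM2l a0); apply: (le_trans k3).
  rewrite le_eqVlt; apply/orP; left; apply/eqP; rewrite /a /b.
  by field; rewrite !gt_eqF ?subr_gt0.
have bd0 : 0 <= b * delta := mulr_ge0 b0 delta0.
rewrite -(@ler_pXn2r _ 2) ?nnegrE ?(addr_ge0 d0 bd0) ?mulr_ge0 //.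
have : 0 <= (d - b * delta) ^+ 2 by exact: sqr_ge0.
nra.
Qed.

(** The step D n precedes the value rho n, so that the Lojasiewicz inequality at
    rho n involves D n and the decrease from rho n involves the next step. *)
Section Sequences.
Variables (rho D : nat -> R).
Hypothesis rho_ge0 : forall n, 0 <= rho n.
Hypothesis D_ge0 : forall n, 0 <= D n.
Hypothesis decrease : forall n, a * D n.+1 ^+ 2 <= rho n - rho n.+1.
Hypothesis loj : forall n, 0 < rho n ->
  rho n `^ (1 - p^-1) <= c * (lambda^-1 * D n).

Lemma value_decay (n : nat) : 0 < rho n.+1 ->
  kappa_of lambda L c * rho n.+1 `^ (2 - 2 / p) <= rho n - rho n.+1.
Proof. by move=> r0; exact: step_decay (decrease n) (loj r0). Qed.

Lemma value_nonincreasing (n m : nat) : (n <= m)%N -> rho m <= rho n.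
Proof.
have /nonincreasing_seqP : forall k, rho k.+1 <= rho k; last by apply.
move=> k; rewrite -subr_ge0; apply: le_trans (decrease k).
by rewrite mulr_ge0 ?sqr_ge0 // ltW // decrease_rate_gt0.
Qed.

(** Summing the step inequality, half of each step cancels and the decreases of
    phi telescope. *)
Lemma length_le (n N : nat) : 1 <= p ->
  \sum_(n <= k < (n + N)%N) D k.+1 <=
  D n + 2 * p * c / (2 - lambda * L) * rho n `^ p^-1.
Proof.
move=> p1; set b := 2 * p * c / (2 - lambda * L).
have b0 : 0 <= b.
  by rewrite divr_ge0 ?mulr_ge0 ?subr_ge0 ?(ltW hc) ?(ltW hlL) // (le_trans ler01).
suff : \sum_(n <= k < (n + N)%N) D k.+1 + (D (n + N)%N + b * rho (n + N)%N `^ p^-1)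
       <= D n + b * rho n `^ p^-1.
  by apply: le_trans; rewrite lerDl addr_ge0 ?(mulr_ge0 b0) ?powR_ge0 ?D_ge0.
elim: N => [|N IH]; first by rewrite addn0 big_geq // add0r.
apply: le_trans IH; rewrite addnS big_nat_recr ?leq_addr //=.
have := step_length p1 (rho_ge0 (n + N)%N) (rho_ge0 (n + N).+1) (D_ge0 _) (D_ge0 _)
  (decrease (n + N)%N) (@loj _).
rewrite -/b mulrBr; lra.
Qed.

(** While the values stay above e, each step lowers them by at least a fixed
    amount, since the exponent is nonnegative for p >= 1. *)
Lemma value_cvg0 (e : R) : 1 <= p -> 0 < e -> exists N, forall n,
  (N <= n)%N -> rho n <= e.
Proof.
move=> p1 e0; have p0 : 0 < p := lt_le_trans ltr01 p1.
have beta0 : 0 <= 2 - 2 / p by rewrite subr_ge0 ler_pdivrMr //; lra.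
have k0 := kappa_gt0.
suff [N rN] : exists N, rho N <= e.
  by exists N => n Nn; apply: le_trans rN; exact: value_nonincreasing.
apply: contrapT => /forallNP ne.
have re n : e < rho n by rewrite ltNge; apply/negP; exact: ne.
set q := kappa_of lambda L c * e `^ (2 - 2 / p).
have q0 : 0 < q by rewrite mulr_gt0 // powR_gt0.
have lin n : rho n <= rho 0%N - n%:R * q.
  elim: n => [|n IH]; first by rewrite mul0r subr0.
  have := value_decay (lt_trans e0 (re n.+1)).
  have : q <= kappa_of lambda L c * rho n.+1 `^ (2 - 2 / p).
    rewrite ler_pM2l // ge0_ler_powR ?nnegrE ?(ltW e0) //.
    exact/ltW/re.
  by rewrite -addn1 natrD; lra.
have := lin (Num.truncn (rho 0%N / q)).+1.
have : rho 0%N < (Num.truncn (rho 0%N / q)).+1%:R * q.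
  by rewrite -ltr_pdivrMr // truncnS_gt.
have := rho_ge0 (Num.truncn (rho 0%N / q)).+1; lra.
Qed.

End Sequences.
End StepInequalities.

(** * The constant of the sublinear rate *)

Section SublinearConstant.
Context {R : realType}.
Variables (p kappa M : R).
Hypotheses (hp : p < 0 \/ 2 < p) (hk : 0 < kappa) (hM : 0 < M).

Let gamma := (p - 2) / p.
Let theta := (p - 2) / (2 * p - 2).

Let p_neq0 : p != 0.
Proof. by case: hp => ?; [rewrite lt_eqF | rewrite gt_eqF //; lra]. Qed.

Let p_neq1 : 2 * p - 2 != 0.
Proof. by case: hp => ?; [rewrite lt_eqF | rewrite gt_eqF]; lra. Qed.

Lemma gamma_gt0 : 0 < gamma.
Proof.
case: hp => h; last by rewrite divr_gt0; lra.
by rewrite /gamma -mulrNN -invrN divr_gt0; lra.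
Qed.

Lemma theta_gt0 : 0 < theta.
Proof.
case: hp => h; last by rewrite divr_gt0; lra.
by rewrite /theta -mulrNN -invrN divr_gt0; lra.
Qed.

Let balance := kappa `^ ((2 - p) / (2 * p - 2)) * M `^ ((2 - p) / p).

Let balance_gt0 : 0 < balance.
Proof. by rewrite mulr_gt0 // powR_gt0. Qed.

Lemma C'_objectiveE (s : R) : C'_objective kappa p M s =
  Num.min (gamma / s) (balance * (1 - s `^ (- theta))).
Proof. by rewrite /C'_objective invfM mulrA. Qed.

Lemma powRN_le1 (s : R) : 1 <= s -> s `^ (- theta) <= 1.
Proof.
by move=> s1; rewrite powRN invf_le1 ?powR_gt0 -1?(powRr0 s) ?ler_powR ?(ltW theta_gt0) //; lra.
Qed.

(** The first term of the objective decreases from a positive value to 0 and the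
    second one increases from 0 to a positive value; the maximum of their
    minimum is attained where they cross. *)
Lemma C'_objective_crossing : exists2 s : R, 1 <= s &
  balance * (1 - s `^ (- theta)) = gamma / s.
Proof.
have g0 := gamma_gt0; have t0 := theta_gt0; have b0 := balance_gt0.
(* At s1 the second term is at least half of balance and the first at most that. *)
pose s1 := Num.max 1 (Num.max (2 `^ theta^-1) (2 * gamma / balance)).
have s1_ge1 : 1 <= s1 by rewrite le_max lexx.
pose F s := balance * (1 - s `^ (- theta)) - gamma * s^-1.
have cF : {within `[1, s1], continuous F}.
  apply: continuous_in_subspaceT => s; rewrite inE /= in_itv /= => /andP[s1' _].
  have s0 : 0 < s by exact: lt_le_trans s1'.
  apply: cvgB; apply: cvgM; try exact: cvg_cst.
    apply: cvgB; first exact: cvg_cst.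
    have /derivable1_diffP/differentiable_continuous : derivable ((@powR R) ^~ (- theta)) s 1.
      by apply: derivable_powR; rewrite in_itv /= s0.
    exact.
  by apply: cvgV; [rewrite gt_eqF | exact: cvg_id].
have F1 : F 1 <= 0.
  by rewrite /F powR1 subrr mulr0 sub0r invr1 mulr1 oppr_le0 ltW.
have Fs1 : 0 <= F s1.
  have s10 : 0 < s1 by exact: lt_le_trans s1_ge1.
  have h1 : s1 `^ (- theta) <= 2^-1.
    rewrite powRN lef_pV2 ?posrE ?powR_gt0 //.
    have -> : 2 = (2 `^ theta^-1) `^ theta.
      by rewrite -powRrM mulVf ?gt_eqF // powRr1.
    rewrite ge0_ler_powR ?nnegrE ?powR_ge0 ?(ltW t0) ?(ltW s10) //.
    by rewrite !le_max lexx orbT.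
  have h2 : gamma * s1^-1 <= balance / 2.
    have : 2 * gamma / balance <= s1 by rewrite !le_max lexx !orbT.
    by rewrite (ler_pdivrMr _ _ b0) (ler_pdivrMr _ _ s10); lra.
  have : balance * 2^-1 <= balance * (1 - s1 `^ (- theta)) by rewrite ler_pM2l //; lra.
  by rewrite /F; lra.
have [|s /[!in_itv]/= /andP[s1s _] Fs] := IVT s1_ge1 cF (v := 0).
  by rewrite ge_min F1 le_max Fs1 orbT.
by exists s => //; apply/eqP; rewrite -subr_eq0; apply/eqP.
Qed.

Lemma is_C'_exists : exists2 C' : R, 0 < C' & is_C' kappa p M C'.
Proof.
have g0 := gamma_gt0; have t0 := theta_gt0; have b0 := balance_gt0.
have [s s1 sE] := C'_objective_crossing.
have s0 : 0 < s by exact: lt_le_trans s1.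
exists (Num.min kappa (kappa `^ theta) * (gamma / s))^-1.
  by rewrite invr_gt0 mulr_gt0 ?lt_min ?hk ?powR_gt0 // divr_gt0.
exists (gamma / s); last by rewrite invrK.
split; first by exists s; [rewrite /= in_itv /= s1 | rewrite C'_objectiveE sE minxx].
apply/ubP => _ [t + <-]; rewrite /= in_itv /= andbT => t1.
have t0' : 0 < t by exact: lt_le_trans t1.
rewrite C'_objectiveE ge_min; have [st|ts] := leP s t.
  by rewrite ler_pM2l // lef_pV2 ?posrE // st.
apply/orP; right; rewrite -sE ler_pM2l // lerD2l lerN2 !powRN.
rewrite lef_pV2 ?posrE ?powR_gt0 // ge0_ler_powR ?nnegrE ?(ltW t0) ?(ltW s0) ?(ltW t0') //.
exact: ltW.
Qed.

Section Growth.
Variable C' : R.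
Hypothesis hC' : is_C' kappa p M C'.

(** With s a maximizer, the first bound will serve when consecutive values are
    comparable up to s and the second when the value drops by more than that. *)
Lemma is_C'_bounds : exists2 s : R, 1 <= s &
  C'^-1 <= kappa * (gamma / s) /\
  C'^-1 <= M `^ (- gamma) * (1 - s `^ (- theta)).
Proof.
have g0 := gamma_gt0; have b0 := balance_gt0.
have [_ [[s /= + <-] _] ->] := hC'; rewrite in_itv /= andbT => s1.
exists s => //; have s0 : 0 < s by exact: lt_le_trans s1.
rewrite C'_objectiveE; set A := gamma / s; set B := balance * _.
have A0 : 0 <= A by rewrite divr_ge0 // ltW.
have B0 : 0 <= B.
  by rewrite mulr_ge0 ?(ltW b0) // subr_ge0 powRN_le1.
have m0 : 0 <= Num.min A B by rewrite le_min A0.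
have k0 : 0 <= Num.min kappa (kappa `^ theta) by rewrite le_min powR_ge0 ltW.
split; first by rewrite ler_pM // ge_min lexx.
have -> : M `^ (- gamma) * (1 - s `^ (- theta)) = kappa `^ theta * B.
  rewrite /B /balance !mulrA -powRD; last by rewrite (gt_eqF hk) implybT.
  have -> : theta + (2 - p) / (2 * p - 2) = 0 by rewrite /theta; field.
  by rewrite powRr0 mul1r; congr (_ `^ _ * _); rewrite /gamma; field.
by rewrite ler_pM // ge_min lexx orbT.
Qed.

Lemma is_C'_inv_le : C'^-1 <= M `^ (- gamma).
Proof.
have [s s1 [_ /le_trans]] := is_C'_bounds; apply.
by rewrite ler_piMr ?powR_ge0 // gerBl powR_ge0.
Qed.

(** Either consecutive values are comparable, and the convexity of t^(-gamma)
    applies, or the value drops by a fixed factor. *)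
Lemma inverse_power_growth (u v : R) : 0 < v -> v <= u -> u <= M ->
  kappa * v `^ (2 - 2 / p) <= u - v ->
  C'^-1 <= v `^ (- gamma) - u `^ (- gamma).
Proof.
move=> v0 vu uM dec; have u0 : 0 < u by exact: lt_le_trans vu.
have g0 := gamma_gt0; have t0 := theta_gt0.
have [s s1 [C1 C2]] := is_C'_bounds; have s0 : 0 < s by exact: lt_le_trans s1.
set beta := 2 - 2 / p in dec.
have betaE : gamma + 1 = beta by rewrite /gamma /beta; field.
have [uv|vu'] := leP (u `^ beta) (s * v `^ beta).
  apply: (le_trans C1); apply: le_trans (powRN_convex_gap v0 vu g0).
  rewrite betaE powRN -mulrA mulrCA ler_pM2l //.
  apply: (@le_trans _ _ ((u `^ beta)^-1 * (kappa * v `^ beta))); last first.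
    by rewrite ler_pM2l // invr_gt0 powR_gt0.
  rewrite mulrCA ler_pM2l // mulrC ler_pdivlMr ?powR_gt0 //.
  by rewrite mulrC ler_pdivrMr // mulrC.
apply: (le_trans C2).
have drop : s `^ theta * u `^ (- gamma) <= v `^ (- gamma).
  have tE : beta * theta = gamma by rewrite /beta /theta /gamma; field; rewrite p_neq0.
  have : (s * v `^ beta) `^ theta <= (u `^ beta) `^ theta.
    by rewrite ge0_ler_powR ?nnegrE ?(ltW t0) ?mulr_ge0 ?powR_ge0 ?(ltW s0) ?(ltW vu').
  rewrite powRM ?powR_ge0 ?(ltW s0) // -!powRrM tE => svu.
  rewrite !powRN ler_pdivrMr ?powR_gt0 // mulrC ler_pdivlMr ?powR_gt0 //.
have uMg : M `^ (- gamma) <= u `^ (- gamma).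
  rewrite !powRN lef_pV2 ?posrE ?powR_gt0 // ge0_ler_powR ?nnegrE ?(ltW g0) ?(ltW hM) ?(ltW u0) //.
set w := s `^ theta in drop.
have w1 : 1 <= w by rewrite -(powRr0 s) ler_powR // ltW.
have w0 : 0 < w by exact: lt_le_trans w1.
rewrite (powRN s) -/w.
have wV : 1 - w^-1 <= w - 1.
  have wV0 : 0 < w^-1 by rewrite invr_gt0.
  have : w * w^-1 = 1 by rewrite divff // gt_eqF.
  nra.
have ug0 := powR_gt0 (- gamma) u0; have Mg0 := powR_gt0 (- gamma) hM.
apply: (@le_trans _ _ (u `^ (- gamma) * (w - 1))).
  by apply: ler_pM => //; rewrite ?(ltW Mg0) ?subr_ge0 ?invf_le1.
by rewrite mulrBr mulr1 lerD2r mulrC.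
Qed.

(** The inverse powers grow by 1 / C' at each step and are at least 1 / C' at
    the start, because 1 / C' is at most M^(-gamma). *)
Lemma inverse_power_rate (rho : nat -> R) : 0 < C' ->
  (forall n, 0 <= rho n) -> rho 0%N <= M ->
  (forall n, 0 < rho n.+1 ->
    kappa * rho n.+1 `^ (2 - 2 / p) <= rho n - rho n.+1) ->
  forall n, rho n <= C' `^ (p / (p - 2)) * n.+1%:R `^ (- (p / (p - 2))).
Proof.
move=> C'0 rho0 rhoM dec n.
have pgt0 (k : nat) : 0 < rho k.+1 -> rho k.+1 < rho k.
  move=> r1; rewrite -subr_gt0; apply: lt_le_trans (dec _ r1).
  by rewrite mulr_gt0 // powR_gt0.
have lin k : 0 < rho k -> rho k <= M /\ k.+1%:R * C'^-1 <= rho k `^ (- gamma).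
  elim: k => [|k IH] rk.
    split => //; rewrite mul1r; apply: (le_trans is_C'_inv_le).
    rewrite !powRN lef_pV2 ?posrE ?powR_gt0 // ge0_ler_powR ?nnegrE //.
    - exact/ltW/gamma_gt0.
    - exact: ltW.
  have lt := pgt0 _ rk; have [kM IHk] := IH (lt_trans rk lt).
  split; first exact: le_trans (ltW lt) kM.
  have := inverse_power_growth rk (ltW lt) kM (dec _ rk).
  by rewrite -(addn1 k.+1) natrD; lra.
have [->|rn] := eqVneq (rho n) 0; first by rewrite mulr_ge0 ?powR_ge0.
have {}rn : 0 < rho n by rewrite lt_neqAle eq_sym rn rho0.
have [_ ln] := lin n rn; have g0 := gamma_gt0.
have E : rho n = (rho n `^ (- gamma)) `^ (- gamma^-1).
  by rewrite -powRrM mulrNN divff ?gt_eqF // powRr1 ?ltW.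
have gE : p / (p - 2) = gamma^-1 by rewrite /gamma invf_div.
rewrite gE.
have -> : C' `^ gamma^-1 * n.+1%:R `^ (- gamma^-1) = (n.+1%:R * C'^-1) `^ (- gamma^-1).
  rewrite powRM ?invr_ge0 ?(ltW C'0) // mulrC; congr (_ * _).
  by rewrite -(powR_inv1 (ltW C'0)) -powRrM mulN1r opprK.
have nC : 0 < n.+1%:R * C'^-1 by rewrite mulr_gt0 ?invr_gt0.
have rg := powR_gt0 (- gamma) rn.
rewrite {1}E !(powRN _ gamma^-1) lef_pV2 ?posrE ?powR_gt0 //.
by rewrite ge0_ler_powR ?nnegrE ?invr_ge0 ?(ltW g0) ?(ltW nC) ?(ltW rg).
Qed.

End Growth.
End SublinearConstant.

(** * Sequences of finite length *)

Section FiniteLength.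
Context {R : realType} {X : completeNormedModType R}.

Lemma finite_length_cvg (y : nat -> X) (T : nat -> R) :
  (forall n N, \sum_(n <= k < (n + N)%N) `|y k.+1 - y k| <= T n) ->
  exists l : X, [/\ y n @[n --> \oo] --> l, forall n, `|y n - l| <= T n
    & (\sum_(0 <= k <oo) (`|y k.+1 - y k|)%:E < +oo)%E].
Proof.
move=> yT.
have incr n N : `|y n - y (n + N)%N| <= T n.
  apply: le_trans (yT n N); rewrite distrC -telescope_sumr ?leq_addr //.
  exact: ler_norm_sum.
have cy : cvgn y.
  have -> : y = (fun n => y 0%N + series (telescope y) n).
    by apply/funext => n; exact: eq_sum_telescope.
  apply: is_cvgD; first exact: is_cvg_cst.
  apply: normed_cvg; apply: nondecreasing_is_cvgn.
    by apply: nondecreasing_series => k _ _ /=.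
  by exists (T 0%N) => _ [n _ <-]; have := yT 0%N n; rewrite add0n.
have /cvg_ex[l yl] := cy; exists l; split => // [n|].
  have yn : (fun m => `|y n - y m|) @ \oo --> `|y n - l|.
    by apply: cvg_norm; apply: cvgB; [exact: cvg_cst | exact: yl].
  apply: (cvgr_to_le yn); exists n => // m /= nm.
  by rewrite -(subnKC nm); exact: incr.
apply: (@le_lt_trans _ _ (T 0%N)%:E); last exact: ltry.
apply: lime_le; first by apply: is_cvg_nneseries => k _ _; rewrite lee_fin.
by apply: nearW => n; rewrite sumEFin lee_fin; have := yT 0%N n; rewrite add0n.
Qed.

End FiniteLength.

(** * The constants of the distance estimates *)

Section DistanceConstants.
Context {R : realType}.
Variables (p c lambda L : R).
Hypotheses (hc : 0 < c) (hl : 0 < lambda) (hlL : lambda * L < 2) (hp : 1 <= p).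

Let p_gt0 : 0 < p. Proof. exact: lt_le_trans ltr01 hp. Qed.

Let two_sub_gt0 : 0 < 2 - lambda * L. Proof. by rewrite subr_gt0. Qed.

Lemma C_le2_gt0 (M : R) : 0 < M -> 0 < C_le2 lambda L c p M.
Proof.
move=> M0; rewrite /C_le2 addr_gt0 // ?mulr_gt0 ?powR_gt0 ?invr_gt0 //.
by rewrite mulr_gt0.
Qed.

Lemma C_ge2_gt0 (M : R) : 0 < M -> 0 < C_ge2 lambda L c p M.
Proof.
by move=> M0; rewrite /C_ge2 addr_gt0 // ?mulr_gt0 ?powR_gt0 ?invr_gt0 ?mulr_gt0.
Qed.

Lemma C_ge2_C_le2 (M : R) : 0 < M -> p = 2 ->
  C_ge2 lambda L c p M = C_le2 lambda L c p M.
Proof.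
move=> M0 p2; rewrite /C_ge2 /C_le2 p2 powRM ?mulr_ge0 ?(ltW hl) ?(ltW M0) //.
rewrite !powRN; have := powR_gt0 2^-1 M0; set m := M `^ _ => m0.
by field; rewrite !gt_eqF ?powR_gt0.
Qed.

(** The factor M^(beta - alpha) is kept as the product that occurs in the
    constants. *)
Lemma powR_le_scale (s M alpha beta : R) : 0 <= s -> s <= M -> 0 < M ->
  0 < alpha <= beta -> s `^ beta <= M `^ beta * M `^ (- alpha) * s `^ alpha.
Proof.
move=> s0 sM M0 /andP[a0 ab]; have [->|sn] := eqVneq s 0.
  by rewrite !powR0 ?mulr0 // gt_eqF // (lt_le_trans a0).
have {sn} s_gt0 : 0 < s by rewrite lt_neqAle eq_sym sn.
rewrite -powRD; last by rewrite (gt_eqF M0) implybT.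
have -> : s `^ beta = s `^ (beta - alpha) * s `^ alpha.
  by rewrite -powRD ?subrK // (gt_eqF s_gt0) implybT.
by rewrite ler_wpM2r ?powR_ge0 // ge0_ler_powR ?nnegrE ?subr_ge0 // ltW.
Qed.

(** Here s and t are two consecutive gaps and d is the step between them; the
    smaller of the exponents 1/2 and 1/p prevails once the other power is
    rescaled by means of the bound M. *)
Section Bounds.
Variables (M s t d : R).
Hypotheses (hM : 0 < M) (ht : 0 <= t) (hts : t <= s) (hsM : s <= M) (hd : 0 <= d).
Hypothesis hdec : (2 - lambda * L) / (2 * lambda) * d ^+ 2 <= s - t.

Lemma last_step_le :
  d <= (2 * lambda) `^ 2^-1 * (2 - lambda * L) `^ (- 2^-1) * s `^ 2^-1.
Proof.
have s0 := le_trans ht hts.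
have d2 : d ^+ 2 <= 2 * lambda * (2 - lambda * L)^-1 * s.
  rewrite -(@ler_pM2l _ ((2 - lambda * L) / (2 * lambda))); last first.
    by rewrite divr_gt0 // mulr_gt0.
  have -> : (2 - lambda * L) / (2 * lambda) * (2 * lambda * (2 - lambda * L)^-1 * s) = s.
    by field; rewrite !gt_eqF.
  by apply: (le_trans hdec); rewrite gerBl.
have l0 : 0 <= 2 * lambda by rewrite mulr_ge0 // ltW.
have i0 : 0 <= (2 - lambda * L)^-1 by rewrite invr_ge0 ltW.
have -> : (2 - lambda * L) `^ (- 2^-1) = (2 - lambda * L)^-1 `^ 2^-1.
  by rewrite -(powR_inv1 (ltW two_sub_gt0)) -powRrM mulN1r.
rewrite -(powRM _ l0 i0) -(powRM _ (mulr_ge0 l0 i0) s0).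
have -> : d = (d ^+ 2) `^ 2^-1.
  by rewrite -powR_mulrn // -powRrM divff ?powRr1.
by rewrite ge0_ler_powR ?nnegrE ?sqr_ge0 ?(mulr_ge0 (mulr_ge0 l0 i0) s0).
Qed.

Let b_ge0 : 0 <= 2 * p * c / (2 - lambda * L).
Proof. by rewrite divr_ge0 ?mulr_ge0 ?(ltW p_gt0) ?(ltW hc) ?(ltW two_sub_gt0). Qed.

Let t_le_s : 2 * p * c / (2 - lambda * L) * t `^ p^-1 <=
  2 * p * c / (2 - lambda * L) * s `^ p^-1.
Proof.
by rewrite ler_wpM2l // ge0_ler_powR ?nnegrE ?invr_ge0 ?(ltW p_gt0) // (le_trans ht).
Qed.

Lemma C_le2_bound : p <= 2 ->
  d + 2 * p * c / (2 - lambda * L) * t `^ p^-1 <=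
  C_le2 lambda L c p M * s `^ 2^-1.
Proof.
move=> p2; have s0 := le_trans ht hts.
have i2p : 0 < (2^-1 : R) <= p^-1 by rewrite invr_gt0 ltr0n lef_pV2 ?posrE.
have sc := ler_wpM2l b_ge0 (powR_le_scale s0 hsM hM i2p).
have := last_step_le; rewrite /C_le2 (mulrDl _ _ (s `^ _)) => ld.
rewrite addrC lerD //; apply: (le_trans t_le_s); apply: (le_trans sc).
by rewrite le_eqVlt; apply/orP; left; apply/eqP; ring.
Qed.

Lemma C_ge2_bound : 2 <= p ->
  d + 2 * p * c / (2 - lambda * L) * t `^ p^-1 <=
  C_ge2 lambda L c p M * s `^ p^-1.
Proof.
move=> p2; have s0 := le_trans ht hts.
have i2p : 0 < p^-1 <= (2^-1 : R) by rewrite invr_gt0 p_gt0 lef_pV2 ?posrE.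
have := powR_le_scale s0 hsM hM i2p.
have := last_step_le; rewrite /C_ge2 (mulrDl _ _ (s `^ _)) => ld sc.
rewrite addrC lerD //; apply: (le_trans ld).
have k0 : 0 <= (2 * lambda) `^ 2^-1 * (2 - lambda * L) `^ (- 2^-1).
  by rewrite mulr_ge0 ?powR_ge0.
apply: (le_trans (ler_wpM2l k0 sc)).
rewrite (powRM _ _ (ltW hM)) ?mulr_ge0 ?(ltW hl) //.
by rewrite le_eqVlt; apply/orP; left; apply/eqP; ring.
Qed.

End Bounds.
End DistanceConstants.

(** * Extended powers and the value of the infimum *)

Section ExtendedPowers.
Context {R : realType}.

Lemma epow0N (s : R) : 0 < s -> epow (0%:R%:E : \bar R) (- s) = +oo%E.
Proof.
by move=> s0; rewrite /epow oppr_lt0 s0 opprK poweR0r ?gt_eqF // inve0.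
Qed.

Lemma epowSN (n : nat) (s : R) : 0 < s ->
  epow (n.+1%:R%:E : \bar R) (- s) = (n.+1%:R `^ (- s))%:E.
Proof.
move=> s0; rewrite /epow oppr_lt0 s0 opprK poweR_EFin inver powRN.
by rewrite gt_eqF // powR_gt0.
Qed.

End ExtendedPowers.

Section InfimumValue.
Context {R : realType} {X : normedModType R}.
Variable f : X -> \bar R.
Hypotheses (hbound : bounded_below f) (hdom : dom f !=set0).

Lemma inf_value_le (x : X) : (inf_value f <= f x)%E.
Proof. by apply: ereal_inf_lbound; exists x. Qed.

Lemma inf_value_fin_num : inf_value f \is a fin_num.
Proof.
have [m fm] := hbound; have [a da] := hdom.
rewrite fin_numElt; apply/andP; split; last exact: le_lt_trans (inf_value_le a) da.
apply: (lt_le_trans (ltNyr m)); apply: le_ereal_inf_tmp => _ [u _ <-]; exact: fm.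
Qed.

Lemma argminP (x : X) : argmin f x <-> (f x <= inf_value f)%E.
Proof.
split=> [xmin|fx y]; last exact: le_trans fx (inf_value_le y).
by apply: le_ereal_inf_tmp => _ [u _ <-]; exact: xmin.
Qed.

End InfimumValue.

(** * The forward-backward iterates *)

Section Iterates.
Context {R : realType} {X : completeNormedModType R}.
Variable dot : {dot X for @idfun R}.
Hypothesis hdot : induces_norm dot.
Variables (g : X -> \bar R) (h : X -> R) (gradh : X -> X) (L lambda : R).
Variable f : X -> \bar R.
Hypotheses (hg : Gamma0 g) (hL : 0 < L).
Hypothesis hconv : convex_function setT (h : X -> R^o).
Hypothesis hgrad : is_gradient dot h gradh.
Hypothesis hlip : L.-lipschitz gradh.
Hypothesis hf : forall u, f u = (g u + (h u)%:E)%E.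
Hypothesis hbound : bounded_below f.
Hypothesis hlambda : 0 < lambda < 2 * L^-1.
Variable x : nat -> X.
Hypothesis hx : forall n, x n.+1 = forward_backward g gradh lambda (x n).
Variable Omega : set X.
Hypothesis hOmega : FB_invariant g gradh L Omega.
Hypothesis hx0 : Omega (x 0%N).
Variables p c : R.
Hypotheses (hc : 0 < c) (hloj : lojasiewicz dot f p c Omega).
Variable r : nat -> \bar R.
Hypothesis hr : forall n, r n = (f (x n) - inf_value f)%E.

(** Only the first value can be infinite, so the real gaps are indexed from the
    first iterate on. *)
Let rho (n : nat) : R := fine (r n.+1).
Let D (n : nat) : R := `|x n.+1 - x n|.
Let kappa := kappa_of lambda L c.

Let lambda_gt0 : 0 < lambda := step_gt0 hlambda.
Let lambdaL_lt2 : lambda * L < 2 := step_lipschitz_lt2 hL hlambda.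

Let inf_fin : inf_value f \is a fin_num.
Proof.
apply: inf_value_fin_num => //; have [[_ [a da]] _ _] := hg.
by exists a; apply/(dom_sum hf).
Qed.

Lemma iterate_Omega (n : nat) : Omega (x n).
Proof.
elim: n => // n IH; rewrite hx; apply: (hOmega hlambda).
by exists (x n).
Qed.

Lemma gap_ge0 (n : nat) : (0 <= r n)%E.
Proof. by rewrite hr sube_ge0 ?inf_value_le ?inf_fin ?orbT. Qed.

Lemma value_gapE (n : nat) : f (x n) = (r n + inf_value f)%E.
Proof. by rewrite hr subeK. Qed.

Lemma gapSE (n : nat) : r n.+1 = (rho n)%:E.
Proof.
rewrite /rho fineK // ge0_fin_numE ?gap_ge0 // hr hx.
have dy := forward_backward_dom hdot hg hL hgrad hlip hf hbound hlambda (x n).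
by rewrite lte_add_pinfty // -?fin_numElt ltey_eq fin_numN inf_fin.
Qed.

Lemma rho_nneg (n : nat) : 0 <= rho n.
Proof. by rewrite -lee_fin -gapSE gap_ge0. Qed.

Lemma gap_decrease (n : nat) (s : R) : r n = s%:E ->
  (2 - lambda * L) / (2 * lambda) * D n ^+ 2 <= s - rho n.
Proof.
move=> rs; have := forward_backward_decrease hdot hg hL hgrad hlip hf hbound hlambda (x n).
rewrite -hx !value_gapE rs gapSE -(fineK inf_fin) -!EFinD lee_fin /D distrC.
by rewrite -lerBrDl; move/le_trans; apply; rewrite opprD addrACA subrr addr0.
Qed.

Lemma rho_decrease (n : nat) :
  (2 - lambda * L) / (2 * lambda) * D n.+1 ^+ 2 <= rho n - rho n.+1.
Proof. by apply: gap_decrease; exact: gapSE. Qed.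

Lemma rho_lojasiewicz (n : nat) : 0 < rho n ->
  rho n `^ (1 - p^-1) <= c * (lambda^-1 * D n).
Proof.
move=> r0; have dx : dom_star f (x n.+1).
  split; first by rewrite /dom /= value_gapE gapSE -(fineK inf_fin) -EFinD ltry.
  move/argminP; rewrite value_gapE gapSE -(fineK inf_fin) -EFinD lee_fin.
  by rewrite gerDr leNgt r0.
have := hloj (conj (iterate_Omega n.+1) dx).
rewrite -hr gapSE poweR_EFin.
have sl := forward_backward_slope hdot hg hL hconv hgrad hlip hf hbound hlambda (x n).
rewrite -hx distrC in sl.
move=> /le_trans/(_ (lee_wpmul2l _ sl)); rewrite lee_fin => /(_ (ltW hc)).
by rewrite -EFinM lee_fin.
Qed.

Lemma gap_decay (n : nat) (s : R) : r n = s%:E -> 0 < rho n ->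
  kappa * rho n `^ (2 - 2 / p) <= s - rho n.
Proof.
move=> rs r0.
exact: (step_decay hc lambda_gt0 lambdaL_lt2 (gap_decrease rs) (rho_lojasiewicz r0)).
Qed.

Lemma rho_le_gap (n : nat) (s : R) : r n = s%:E -> rho n <= s.
Proof.
move=> rs; rewrite -subr_ge0; apply: le_trans (gap_decrease rs).
by rewrite mulr_ge0 ?sqr_ge0 // ltW // decrease_rate_gt0.
Qed.

Lemma gap0_stationary (n : nat) : r n = 0%E -> D n = 0 /\ rho n = 0.
Proof.
move=> r0; have rn0 : rho n = 0.
  by apply/eqP; rewrite eq_le rho_nneg (rho_le_gap r0).
split => //; have := gap_decrease r0.
rewrite rn0 subrr pmulr_rle0 ?decrease_rate_gt0 // => D0.
have /eqP : D n ^+ 2 == 0 by rewrite eq_le D0 sqr_ge0.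
by move/eqP; rewrite expf_eq0 /= => /eqP.
Qed.

(** A positive real bound for all the finite gaps, equal to the initial gap
    whenever that gap is positive and finite. *)
Definition gap_bound : R :=
  if (0 < r 0%N < +oo)%E then fine (r 0%N) else fine (r 1%N) + 1.

Lemma gap_bound_gt0 : 0 < gap_bound.
Proof.
rewrite /gap_bound; case: ifPn => [/andP[r0 roo]|_].
  by rewrite fine_gt0 // r0.
by rewrite ltr_wpDl // rho_nneg.
Qed.

Lemma gap_boundE : (0 < r 0%N < +oo)%E -> gap_bound = fine (r 0%N).
Proof. by rewrite /gap_bound => ->. Qed.

Lemma rho0_le_bound : rho 0%N <= gap_bound.
Proof.
rewrite /gap_bound; case: ifPn => [/andP[r0 roo]|_]; last by rewrite lerDl.
by apply: rho_le_gap; rewrite fineK // ge0_fin_numE // ltW.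
Qed.

Lemma rho_nonincreasing (n m : nat) : (n <= m)%N -> rho m <= rho n.
Proof. exact: (value_nonincreasing lambda_gt0 lambdaL_lt2 rho_decrease). Qed.

(** Case analysis on a gap: it is infinite, which happens at most initially, or it
    is a real number below the bound. *)
Variant gap_spec (n : nat) : \bar R -> Type :=
| GapInfinite of n = 0%N & r n = +oo%E : gap_spec n +oo%E
| GapFinite (s : R) of r n = s%:E & 0 <= s & rho n <= s & s <= gap_bound :
    gap_spec n s%:E.

Lemma gapP (n : nat) : gap_spec n (r n).
Proof.
have := gap_ge0 n; case rn : (r n) => [s| |] // s0; last first.
  by case: n rn => [|n rn]; [move=> *; exact: GapInfinite | rewrite gapSE in rn].
apply: GapFinite => //; first exact: rho_le_gap.
case: n rn => [|n] rn.
  move: s0; rewrite le_eqVlt => /orP[/eqP[<-]|s0]; first exact/ltW/gap_bound_gt0.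
  by rewrite gap_boundE rn // s0 ltry.
have -> : s = rho n by move: rn; rewrite gapSE => -[].
exact: le_trans (rho_nonincreasing (leq0n n)) rho0_le_bound.
Qed.

(** Finite length gives a limit, and the values tend to the infimum, so lower
    semicontinuity makes the limit a minimizer. *)
Lemma iterates_cvg : 1 <= p -> exists l : X,
  [/\ argmin f l, x n @[n --> \oo] --> l,
      (\sum_(0 <= n <oo) (`|x n.+1 - x n|)%:E < +oo)%E &
      forall n, `|x n.+1 - l| <=
        D n + 2 * p * c / (2 - lambda * L) * rho n `^ p^-1].
Proof.
move=> p1; set b := 2 * p * c / (2 - lambda * L).
have D0 n : 0 <= D n by exact: normr_ge0.
have lenD n N := length_le hc lambda_gt0 lambdaL_lt2 rho_nneg D0 rho_decrease
  rho_lojasiewicz n N p1.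
(* The first step is counted apart: it is finite, but not controlled by a gap when
   the initial value is infinite. *)
pose T n := if n is m.+1 then D m + b * rho m `^ p^-1
            else D 0%N + (D 0%N + b * rho 0%N `^ p^-1).
have b0 : 0 <= b.
  rewrite /b divr_ge0 ?subr_ge0 ?(ltW lambdaL_lt2) //.
  by rewrite mulr_ge0 ?(ltW hc) // mulr_ge0 // (le_trans ler01).
have [|l [xl lT lsum]] := @finite_length_cvg R X x T.
  case=> [|n] N; last first.
    by rewrite big_add1 /=; exact: (lenD n N).
  rewrite add0n; case: N => [|N].
    by rewrite big_geq //= !addr_ge0 // mulr_ge0 // powR_ge0.
  by rewrite big_nat_recl //= lerD2l; exact: (lenD 0%N N).
exists l; split=> [|//|//|n]; last exact: (lT n.+1).
have lscf : lower_semicontinuous f.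
  have -> : f = (fun u => g u + (h u)%:E)%E by apply/funext.
  have [_ _ lscg] := hg; apply: lower_semicontinuousD lscg _ => u.
  by have [/differentiable_continuous] := hgrad u.
apply/argminP; rewrite -(fineK inf_fin).
apply: (lsc_cvg_le lscf xl) => e e0.
have [N rN] := value_cvg0 hc lambda_gt0 lambdaL_lt2 rho_nneg rho_decrease
  rho_lojasiewicz p1 e0.
exists N.+1 => // -[|n] //= Nn; rewrite value_gapE gapSE -(fineK inf_fin).
by rewrite -EFinD lee_fin addrC lerD2l; exact: rN.
Qed.


(** * Convergence rates *)

Lemma gap_sublinear (C' : R) : p < 0 \/ 2 < p -> 0 < C' ->
  is_C' kappa p gap_bound C' ->
  forall n, (r n <= (C' `^ (p / (p - 2)))%:E
                    * epow n%:R%:E (- (p / (p - 2))))%E.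
Proof.
move=> hp C'0 hC'; have g0 := gamma_gt0 hp.
have q0 : 0 < p / (p - 2) by rewrite -invf_div invr_gt0.
case=> [|n]; first by rewrite epow0N // gt0_muley ?leey // lte_fin powR_gt0.
rewrite gapSE epowSN // -EFinM lee_fin.
apply: (inverse_power_rate hp (kappa_gt0 hc lambda_gt0 lambdaL_lt2)
  gap_bound_gt0 hC' C'0 rho_nneg rho0_le_bound).
exact: (value_decay hc lambda_gt0 lambdaL_lt2 rho_decrease rho_lojasiewicz).
Qed.

Section Rates.
Variable l : X.
Hypothesis hp1 : 1 <= p.
Hypothesis hlim : forall n, `|x n.+1 - l| <=
  D n + 2 * p * c / (2 - lambda * L) * rho n `^ p^-1.

Let p_gt0 : 0 < p. Proof. exact: lt_le_trans ltr01 hp1. Qed.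

Let kappa0 : 0 < kappa := kappa_gt0 hc lambda_gt0 lambdaL_lt2.

(** A vanishing gap makes both terms of the distance estimate vanish, as well as
    the step that separates x n from x n.+1. *)
Lemma gap0_limit (n : nat) : r n = 0%E -> x n = l.
Proof.
move=> /gap0_stationary[D0 r0]; have := hlim n.
rewrite D0 r0 powR0 ?invr_neq0 ?gt_eqF // mulr0 addr0 normr_le0 subr_eq0 => /eqP <-.
by apply/eqP; rewrite eq_sym -subr_eq0 -normr_eq0; apply/eqP.
Qed.

(** For p = 1 the exponent 2 - 2 / p is 0, so every step before reaching the
    infimum lowers the value by at least kappa. *)
Lemma finite_termination (n : nat) : p = 1 ->
  (r 0%N / kappa%:E <= n%:R%:E)%E -> x n = l.
Proof.
move=> p1 r0n; apply: gap0_limit.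
have [s0 r0E] : exists s0 : R, r 0%N = s0%:E.
  move: r0n; case: gapP => [_ _|s r0 _ _ _ _]; last by exists s.
  by rewrite inver gt_eqF // gt0_mulye ?lte_fin ?invr_gt0.
have drop k s : r k = s%:E -> 0 < s -> s <= s0 - k%:R * kappa.
  elim: k s => [|k IH] s.
    by rewrite r0E => -[<-] _; rewrite mul0r subr0.
  rewrite gapSE => -[<-] rk0.
  case: (gapP k) (IH) => [k0 rk|t rk t0 rt _ IHt].
    by move: rk; rewrite k0 r0E.
  have := gap_decay rk rk0; rewrite p1 divr1 subrr powRr0 mulr1.
  have := IHt t erefl; rewrite -(addn1 k) natrD; lra.
move: r0n; rewrite r0E inver gt_eqF // -EFinM lee_fin ler_pdivrMr // => s0n.
case: (gapP n) (drop n) => [n0 rn|s rn s0' _ _ dropn].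
  by move: rn; rewrite n0 r0E.
congr (_%:E); apply/eqP; rewrite eq_le s0' andbT leNgt; apply/negP => sp.
have := dropn s erefl sp; lra.
Qed.

(** Drop the term - r n.+1 from the decay inequality and solve for r n.+1. *)
Lemma gap_superlinear (n : nat) : 1 < p ->
  (r n.+1 <= (r n / kappa%:E) `^ (p / (2 * (p - 1))))%E.
Proof.
move=> p1; have p10 : 0 < p - 1 by rewrite subr_gt0.
have e0 : 0 < p / (2 * (p - 1)) by rewrite divr_gt0 // mulr_gt0.
rewrite inver gt_eqF //; case: (gapP n) => [_ _|s rn s0 rs _].
  by rewrite gt0_mulye ?lte_fin ?invr_gt0 // poweRyr ?gt_eqF // leey.
rewrite gapSE -EFinM poweR_EFin lee_fin.
have [->|rn0] := eqVneq (rho n) 0; first exact: powR_ge0.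
have {}rn0 : 0 < rho n by rewrite lt_neqAle eq_sym rn0 rho_nneg.
have {1}-> : rho n = (rho n `^ (2 - 2 / p)) `^ (p / (2 * (p - 1))).
  rewrite -powRrM; have -> : (2 - 2 / p) * (p / (2 * (p - 1))) = 1.
    by field; rewrite !gt_eqF.
  by rewrite powRr1 // ltW.
rewrite ge0_ler_powR ?nnegrE ?(ltW e0) ?powR_ge0 ?(divr_ge0 s0 (ltW kappa0)) //.
rewrite ler_pdivlMr // mulrC; apply: le_trans (gap_decay rn rn0) _.
by rewrite gerBl ltW.
Qed.

Lemma distance_le2 (n : nat) : p <= 2 ->
  ((`|x n.+1 - l|)%:E <=
    (C_le2 lambda L c p gap_bound)%:E * r n `^ (2^-1))%E.
Proof.
move=> p2; case: (gapP n) => [_ _|s rn s0 rs sM].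
  rewrite poweRyr ?gt_eqF ?invr_gt0 // gt0_muley ?leey // lte_fin.
  exact: (C_le2_gt0 hc lambda_gt0 lambdaL_lt2 hp1 gap_bound_gt0).
rewrite poweR_EFin -EFinM lee_fin; apply: le_trans (hlim n) _.
exact: (C_le2_bound hc lambda_gt0 lambdaL_lt2 hp1 gap_bound_gt0 (rho_nneg n) rs sM
  (normr_ge0 _) (gap_decrease rn)).
Qed.

Lemma distance_ge2 (n : nat) : 2 <= p ->
  `|x n.+2 - l| <= C_ge2 lambda L c p gap_bound * rho n `^ p^-1.
Proof.
move=> p2; apply: le_trans (hlim n.+1) _.
apply: (C_ge2_bound hc lambda_gt0 lambdaL_lt2 hp1 gap_bound_gt0 (rho_nneg n.+1)
  _ _ (normr_ge0 _) (rho_decrease n) p2).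
  exact: rho_nonincreasing.
exact: le_trans (rho_nonincreasing (leq0n n)) rho0_le_bound.
Qed.

Lemma gap_linear (n : nat) : p = 2 ->
  (r n.+1 <= ((1 + kappa)^-1)%:E * r n)%E.
Proof.
move=> p2; have k1 : 0 < 1 + kappa by rewrite addr_gt0.
case: (gapP n) => [_ _|s rn s0 rs sM].
  by rewrite gt0_muley ?leey // lte_fin invr_gt0.
rewrite gapSE -EFinM lee_fin.
have [->|rn0] := eqVneq (rho n) 0; first by rewrite mulr_ge0 // invr_ge0 ltW.
have {}rn0 : 0 < rho n by rewrite lt_neqAle eq_sym rn0 rho_nneg.
have := gap_decay rn rn0; rewrite p2 divff ?pnatr_eq0 //.
have -> : 2 - 1 = 1 :> R by lra.
rewrite powRr1 ?(ltW rn0) // => dec.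
by rewrite mulrC ler_pdivlMr // mulrDr mulr1 -lerBrDl mulrC.
Qed.

Lemma gap_geometric (s0 : R) (n : nat) : p = 2 -> r 0%N = s0%:E ->
  (r n <= (s0 * (1 + kappa) `^ (- n%:R))%:E)%E.
Proof.
move=> p2 r0; have k1 : 0 < 1 + kappa by rewrite addr_gt0.
elim: n => [|n IH]; first by rewrite oppr0 powRr0 mulr1 r0.
apply: (le_trans (gap_linear n p2)).
apply: (le_trans (lee_wpmul2l _ IH)); first by rewrite lee_fin invr_ge0 ltW.
rewrite -EFinM lee_fin -addn1 natrD opprD powRD; last by rewrite (gt_eqF k1) implybT.
by rewrite (powR_inv1 (ltW k1)) mulrA mulrC.
Qed.

Lemma distance_linear (n : nat) : p = 2 ->
  ((`|x n.+1 - l|)%:E <=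
     (C_le2 lambda L c p gap_bound)%:E * r 0%N `^ (2^-1)
     * ((1 + kappa) `^ (- (n%:R / 2)))%:E)%E.
Proof.
move=> p2; have k1 : 0 < 1 + kappa by rewrite addr_gt0.
have C0 := C_le2_gt0 hc lambda_gt0 lambdaL_lt2 hp1 gap_bound_gt0.
case: (gapP 0%N) => [_ _|s0 r0 s00 _ _].
  rewrite poweRyr ?gt_eqF ?invr_gt0 // gt0_muley ?lte_fin // gt0_mulye ?leey //.
  by rewrite lte_fin powR_gt0.
have := gap_geometric n p2 r0; have p2' : p <= 2 by rewrite p2.
have := distance_le2 n p2'.
case: (gapP n) => [_ _|s rn s_ge0 _ _]; first by rewrite leye_eq.
rewrite !poweR_EFin -!EFinM !lee_fin => dl sg; apply: (le_trans dl).
rewrite -mulrA ler_wpM2l ?(ltW C0) //.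
have -> : s0 `^ 2^-1 * (1 + kappa) `^ (- (n%:R / 2)) =
          (s0 * (1 + kappa) `^ (- n%:R)) `^ 2^-1.
  by rewrite powRM ?powR_ge0 // -powRrM mulNr.
by rewrite ge0_ler_powR ?nnegrE ?invr_ge0 ?mulr_ge0 ?powR_ge0.
Qed.

Lemma distance_sublinear (C' : R) : 2 < p -> 0 < C' ->
  is_C' kappa p gap_bound C' ->
  forall n, ((`|x n.+1 - l|)%:E <=
     (C_ge2 lambda L c p gap_bound * C' `^ (1 / (p - 2)))%:E
     * epow n%:R%:E (- (1 / (p - 2))))%E.
Proof.
move=> p2 C'0 hC'; have p20 : 0 < p - 2 by rewrite subr_gt0.
have q0 : 0 < 1 / (p - 2) by rewrite divr_gt0.
have C0 := C_ge2_gt0 hc lambda_gt0 lambdaL_lt2 hp1 gap_bound_gt0.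
case=> [|n].
  by rewrite epow0N // gt0_muley ?leey // lte_fin mulr_gt0 // powR_gt0.
rewrite epowSN // -EFinM lee_fin; apply: (le_trans (distance_ge2 n (ltW p2))).
rewrite -mulrA ler_wpM2l ?(ltW C0) //.
have := gap_sublinear (or_intror p2) C'0 hC' n.+1.
rewrite gapSE epowSN; last by rewrite divr_gt0.
rewrite -EFinM lee_fin => rn.
have -> : C' `^ (1 / (p - 2)) * n.+1%:R `^ (- (1 / (p - 2))) =
  (C' `^ (p / (p - 2)) * n.+1%:R `^ (- (p / (p - 2)))) `^ p^-1.
  rewrite powRM ?powR_ge0 // -!powRrM mulNr.
  by have -> : p / (p - 2) / p = 1 / (p - 2) by field; rewrite !gt_eqF.
by rewrite ge0_ler_powR ?nnegrE ?invr_ge0 ?(ltW p_gt0) ?mulr_ge0 ?powR_ge0 ?rho_nneg.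
Qed.

End Rates.
End Iterates.

Unset Implicit Arguments.
Set Strict Implicit.

(** * The theorem *)

Theorem corollary4p11 (R : realType) (X : completeNormedModType R)
  (dot : {dot X for @idfun R}) (hdot : induces_norm dot)
  (g : X -> \bar R) (hg : Gamma0 g)
  (h : X -> R) (gradh : X -> X) (L : R) (hL : 0 < L)
  (hconv : convex_function setT (h : X -> R^o))
  (hgrad : is_gradient dot h gradh)
  (hlip : L.-lipschitz gradh)
  (f : X -> \bar R) (hf : forall u, f u = (g u + (h u)%:E)%E)
  (hbound : bounded_below f)
  (lambda : R) (hlambda : 0 < lambda < 2 * L^-1)
  (x : nat -> X) (hx : forall n, x n.+1 = forward_backward g gradh lambda (x n))
  (Omega : set X) (hOmega : FB_invariant g gradh L Omega)
  (hx0 : Omega (x 0%N))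
  (p : R) (hp : p < 0 \/ 1 <= p)
  (c : R) (hc : 0 < c) (hloj : lojasiewicz dot f p c Omega)
  (r : nat -> \bar R) (hr : forall n, r n = (f (x n) - inf_value f)%E)
  (kappa : R) (hkappa : kappa = kappa_of lambda L c) :
  (1 <= p ->
    (\sum_(0 <= n <oo) (`|x n.+1 - x n|)%:E < +oo)%E /\
    exists xinf : X,
    [/\ argmin f xinf,
        x n @[n --> \oo] --> xinf &
        exists C C' : R,
        [/\ 0 < C /\ 0 < C',
            (0 < r 0%N < +oo)%E ->
              [/\ 2 <= p -> C = C_ge2 lambda L c p (fine (r 0%N)),
                  p <= 2 -> C = C_le2 lambda L c p (fine (r 0%N))
                & 2 < p -> is_C' kappa p (fine (r 0%N)) C'] &
            [/\ p = 1 -> forall n,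
                  (r 0%N / kappa%:E <= n%:R%:E)%E -> x n = xinf,
                1 < p < 2 -> forall n,
                  (r n.+1 <= (r n / kappa%:E) `^ (p / (2 * (p - 1))))%E /\
                  ((`|x n.+1 - xinf|)%:E <= C%:E * r n `^ (2^-1))%E,
                p = 2 -> forall n,
                  (r n.+1 <= ((1 + kappa)^-1)%:E * r n)%E /\
                  ((`|x n.+1 - xinf|)%:E <=
                     C%:E * r 0%N `^ (2^-1)
                     * ((1 + kappa) `^ (- (n%:R / 2)))%:E)%E
              & 2 < p -> forall n,
                  (r n <= (C' `^ (p / (p - 2)))%:E
                          * epow n%:R%:E (- (p / (p - 2))))%E /\
                  ((`|x n.+1 - xinf|)%:E <=
                     (C * C' `^ (1 / (p - 2)))%:E
                     * epow n%:R%:E (- (1 / (p - 2))))%E]]]) /\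
  (p < 0 ->
    exists C' : R,
    [/\ 0 < C',
        (0 < r 0%N < +oo)%E -> is_C' kappa p (fine (r 0%N)) C' &
        forall n,
          (r n <= (C' `^ (p / (p - 2)))%:E
                  * epow n%:R%:E (p / (2 - p)))%E]).
Proof.
rewrite hkappa {kappa hkappa}; set kappa := kappa_of lambda L c.
have lambdaL_lt2 := step_lipschitz_lt2 hL hlambda.
have kappa0 : 0 < kappa := kappa_gt0 hc (step_gt0 hlambda) lambdaL_lt2.
set M := gap_bound r.
have M0 : 0 < M := gap_bound_gt0 hdot hg hL hgrad hlip hf hbound hlambda hx hr.
have ME : (0 < r 0%N < +oo)%E -> M = fine (r 0%N) by exact: gap_boundE.
split=> [p1|p0]; last first.
  have [C' C'0 hC'] := is_C'_exists (or_introl p0) kappa0 M0.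
  exists C'; split=> [//|/ME <- //|n].
  have -> : p / (2 - p) = - (p / (p - 2)) by rewrite -(opprB p) invrN mulrN.
  exact: (gap_sublinear hdot hg hL hconv hgrad hlip hf hbound hlambda hx hOmega
    hx0 hc hloj hr (or_introl p0) C'0 hC').
have [l [lmin xl lsum hlim]] := iterates_cvg hdot hg hL hconv hgrad hlip hf
  hbound hlambda hx hOmega hx0 hc hloj hr p1.
split=> //; exists l; split=> //.
(* For p <= 2 the constant C' may be any positive number. *)
have [C' C'0 hC'] : exists2 C', 0 < C' & 2 < p -> is_C' kappa p M C'.
  have [p2|_] := ltP 2 p; last by exists 1.
  by have [C' C'0 ?] := is_C'_exists (or_intror p2) kappa0 M0; exists C'.
pose C := if p <= 2 then C_le2 lambda L c p M else C_ge2 lambda L c p M.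
(* At p = 2 the two formulas for the constant agree. *)
have C_ge2E : 2 <= p -> C = C_ge2 lambda L c p M.
  rewrite /C; case: ifPn => // p2 p2'.
  by rewrite C_ge2_C_le2 ?(step_gt0 hlambda) //; apply: le_anti; rewrite p2 p2'.
have C_le2E : p <= 2 -> C = C_le2 lambda L c p M by rewrite /C => ->.
have C0 : 0 < C.
  rewrite /C; case: ifP => _.
    exact: (C_le2_gt0 hc (step_gt0 hlambda) lambdaL_lt2 p1 M0).
  exact: (C_ge2_gt0 hc (step_gt0 hlambda) lambdaL_lt2 p1 M0).
exists C, C'; split=> [//|/ME <- //|].
split=> [p_eq1 n|/andP[p_gt1 p_lt2] n|p_eq2 n|p_gt2 n].
- exact: (finite_termination hdot hg hL hconv hgrad hlip hf hbound hlambda hx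
    hOmega hx0 hc hloj hr p1 hlim p_eq1).
- split; first exact: (gap_superlinear hdot hg hL hconv hgrad hlip hf hbound
    hlambda hx hOmega hx0 hc hloj hr p1).
  rewrite (C_le2E (ltW p_lt2)).
  exact: (distance_le2 hdot hg hL hgrad hlip hf hbound hlambda hx hc hr p1 hlim
    n (ltW p_lt2)).
- split; first exact: (gap_linear hdot hg hL hconv hgrad hlip hf hbound
    hlambda hx hOmega hx0 hc hloj hr n p_eq2).
  rewrite C_le2E ?p_eq2 // -{1}p_eq2.
  exact: (distance_linear hdot hg hL hconv hgrad hlip hf hbound hlambda hx
    hOmega hx0 hc hloj hr p1 hlim n p_eq2).
- split; first exact: (gap_sublinear hdot hg hL hconv hgrad hlip hf hbound
    hlambda hx hOmega hx0 hc hloj hr (or_intror p_gt2) C'0 (hC' p_gt2)).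
  rewrite (C_ge2E (ltW p_gt2)).
  exact: (distance_sublinear hdot hg hL hconv hgrad hlip hf hbound hlambda hx
    hOmega hx0 hc hloj hr p1 hlim p_gt2 C'0 (hC' p_gt2)).
Qed.
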